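(* The following decompositions hold, orthogonal in $L^2\Lambda^k(\Omega)$. For $1\le k\le n$, $$\mathcal{P}_0\Lambda^k(\mathcal{G}_h)=\mathcal{R}(d^{k-1}_h,\mathbf{W}^{\rm nc}_h\Lambda^{k-1})\oplus^\perp\mathcal{N}(\delta_k,\mathbf{W}^*_{h0}\Lambda^k)=\mathcal{R}(d^{k-1}_h,\mathbf{W}^{\rm nc}_{h0}\Lambda^{k-1})\oplus^\perp\mathcal{N}(\delta_k,\mathbf{W}^*_h\Lambda^k);$$ for $0\le k\le n-1$, $$\mathcal{P}_0\Lambda^k(\mathcal{G}_h)=\mathcal{N}(d^k_h,\mathbf{W}^{\rm nc}_h\Lambda^k)\oplus^\perp\mathcal{R}(\delta_{k+1},\mathbf{W}^*_{h0}\Lambda^{k+1})=\mathcal{N}(d^k_h,\mathbf{W}^{\rm nc}_{h0}\Lambda^k)\oplus^\perp\mathcal{R}(\delta_{k+1},\mathbf{W}^*_h\Lambda^{k+1}).$$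
   Context: Let $n\ge 1$, let $\Omega\subset\mathbb{R}^n$ be a bounded polyhedral domain and $\mathcal{G}_h$ a simplicial subdivision of $\Omega$. $\mathcal{N}(T,D)=\{v\in D:Tv=0\}$, $\mathcal{R}(T,D)=\{Tv:v\in D\}$, and $\oplus^\perp$ denotes the orthogonal direct sum. Forms. $d^k$ is the exterior derivative on $k$-forms, $\star$ the Hodge star, $\langle\cdot,\cdot\rangle_{L^2\Lambda^k}$ the $L^2(\Omega)$ inner product, and $\delta_k$ the codifferential on $k$-forms, i.e. the formal adjoint of $d^{k-1}$: $\langle d^{k-1}\mu,\eta\rangle_{L^2\Lambda^k}=\langle\mu,\delta_k\eta\rangle_{L^2\Lambda^{k-1}}$ whenever one of the smooth forms $\mu,\eta$ has compact support (thus $\delta_k=\pm\star d^{n-k}\star$). For $1\le k\le n$, $H^*\Lambda^k(\Omega)=\{\mu\in L^2\Lambda^k(\Omega):\delta_k\mu\in L^2\Lambda^{k-1}(\Omega)\}$ with the graph norm, and $H^*_0\Lambda^k(\Omega)$ is the closure in it of smooth compactly supported forms. Whitney forms. $\mathcal{P}_0\Lambda^k$ denotes constant-coefficient $k$-forms. The Koszul operator is $\kappa(dx^{\alpha_1}\wedge\dots\wedge dx^{\alpha_k})=\sum_{j=1}^k(-1)^{j+1}x^{\alpha_j}dx^{\alpha_1}\wedge\dots\wedge\widehat{dx^{\alpha_j}}\wedge\dots\wedge dx^{\alpha_k}$; $\mathcal{P}_1^-\Lambda^k=\mathcal{P}_0\Lambda^k+\kappa(\mathcal{P}_0\Lambda^{k+1})$,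 $\mathcal{P}_1^{*,-}\Lambda^k=\star(\mathcal{P}_1^-\Lambda^{n-k})$. $\mathcal{P}_0\Lambda^k(\mathcal{G}_h)$, $\mathcal{P}_1^-\Lambda^k(\mathcal{G}_h)$, $\mathcal{P}_1^{*,-}\Lambda^k(\mathcal{G}_h)$ are the corresponding piecewise spaces (no inter-element continuity). $d^k_h$ is $d^k$ applied cell by cell. Spaces. $\mathbf{W}^*_h\Lambda^k=\mathcal{P}_1^{*,-}\Lambda^k(\mathcal{G}_h)\cap H^*\Lambda^k(\Omega)$, $\mathbf{W}^*_{h0}\Lambda^k=\mathcal{P}_1^{*,-}\Lambda^k(\mathcal{G}_h)\cap H^*_0\Lambda^k(\Omega)$. For $0\le k\le n-1$, $\mathbf{W}^{\rm nc}_h\Lambda^k=\{\omega_h\in\mathcal{P}_1^-\Lambda^k(\mathcal{G}_h):\langle\omega_h,\delta_{k+1}\eta_h\rangle_{L^2\Lambda^k}-\langle d^k_h\omega_h,\eta_h\rangle_{L^2\Lambda^{k+1}}=0\ \forall\,\eta_h\in\mathbf{W}^*_{h0}\Lambda^{k+1}\}$, and $\mathbf{W}^{\rm nc}_{h0}\Lambda^k$ is defined in the same way but with the condition for all $\eta_h\in\mathbf{W}^*_h\Lambda^{k+1}$. *)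

(* Defs.v *)
From HB Require Import structures.
From mathcomp Require Import all_boot all_order all_algebra.
From mathcomp Require Import all_classical all_reals all_analysis.

Set Implicit Arguments.
Unset Strict Implicit.
Unset Printing Implicit Defensive.
Import Order.TTheory GRing.Theory Num.Theory.
Import numFieldNormedType.Exports.
Local Open Scope classical_set_scope.
Local Open Scope ring_scope.

(* Lebesgue measure on row vectors, on the sigma-algebra generated by the
   coordinates, by recursion on n: the dirac measure at the only point for
   n = 0, then the product with the one-dimensional Lebesgue measure along
   R * R^n = R^(n+1). *)
Section RowVectorSigmaAlgebra.
Context {R : realType} {n : nat}.

Definition coords (i : 'I_n) (x : 'rV[R]_n) : measurableTypeR R := x ord0 i.

Let rV_set0 : g_sigma_preimage coords set0.
Proof. exact: sigma_algebra0. Qed.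

Let rV_setC A : g_sigma_preimage coords A -> g_sigma_preimage coords (~` A).
Proof. exact: sigma_algebraC. Qed.

Let rV_bigcup (F : (set 'rV[R]_n)^nat) :
  (forall i, g_sigma_preimage coords (F i)) ->
  g_sigma_preimage coords (\bigcup_i (F i)).
Proof. exact: sigma_algebra_bigcup. Qed.

HB.instance Definition _ :=
  @isMeasurable.Build (measure_tuple_display default_measure_display)
    'rV[R]_n (g_sigma_preimage coords) rV_set0 rV_setC rV_bigcup.

Lemma measurable_coords (i : 'I_n) : measurable_fun setT (coords i).
Proof.
move=> _ Y mY; rewrite setTI; apply: sub_sigma_algebra => /=.
rewrite -bigcup_seq/=; exists i => /=; first by rewrite mem_index_enum.
by exists Y => //; rewrite setTI.
Qed.

Lemma measurable_fun_coordsP d (S : measurableType d) (f : S -> 'rV[R]_n) :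
  (forall i, measurable_fun setT (coords i \o f)) -> measurable_fun setT f.
Proof.
move=> mf.
have sub : g_sigma_preimage (fun i => coords i \o f) `<=` measurable.
  apply: smallest_sub; first exact: sigma_algebra_measurable.
  rewrite -bigcup_seq; apply: bigcup_sub => i _.
  by move=> A [B mB <-]; exact: mf.
move: sub; rewrite g_sigma_preimage_comp => sub.
by move=> _ A mA; apply: sub; exists A.
Qed.

End RowVectorSigmaAlgebra.

Section LebesgueMeasure.
Context {R : realType}.

Definition rV_cons n (p : measurableTypeR R * 'rV[R]_n) : 'rV[R]_n.+1 :=
  row_mx (p.1%:M : 'rV[R]_1) p.2.

Definition rV_uncons n (x : 'rV[R]_n.+1) : measurableTypeR R * 'rV[R]_n :=
  (x ord0 ord0, \row_i x ord0 (lift ord0 i)).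

Lemma rV_consK n : cancel (@rV_cons n) (@rV_uncons n).
Proof.
case=> a v; congr pair.
  transitivity ((row_mx (a%:M : 'rV[R]_1) v) ord0 (lshift n ord0)).
    by congr (row_mx _ _ _ _); exact/val_inj.
  by rewrite row_mxEl mxE.
apply/rowP => i; rewrite mxE.
transitivity ((row_mx (a%:M : 'rV[R]_1) v) ord0 (rshift 1 i)).
  by congr (row_mx _ _ _ _); exact/val_inj.
by rewrite row_mxEr.
Qed.

Lemma measurable_rV_cons n : measurable_fun setT (@rV_cons n).
Proof.
apply: measurable_fun_coordsP => i.
have [->|[j ->]] : i = lshift n (ord0 : 'I_1) \/ exists j, i = rshift 1 j.
- case: (@split_ordP 1 n i) => j ->; last by right; exists j.
  by left; rewrite (ord1 j).
- rewrite (_ : _ \o _ = fst) //.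
  by apply/funext => -[a v]; rewrite [LHS](row_mxEl (a%:M : 'rV_1) v) mxE.
- rewrite (_ : _ \o _ = coords j \o snd); last first.
    by apply/funext => -[a v]; rewrite [LHS](row_mxEr (a%:M : 'rV_1) v).
  by apply: measurableT_comp => //; exact: measurable_coords.
Qed.

Lemma measurable_rV_uncons n : measurable_fun setT (@rV_uncons n).
Proof.
apply/measurable_fun_pairP; split.
- exact: (@measurable_coords R n.+1 ord0).
- apply: measurable_fun_coordsP => i.
  rewrite (_ : _ \o _ = coords (lift ord0 i)); first exact: measurable_coords.
  by apply/funext => x /=; rewrite /coords/= mxE.
Qed.

Section Step.
Context {n : nat} (m : {sigma_finite_measure set 'rV[R]_n -> \bar R}).

Definition lebesgue_step : set 'rV[R]_n.+1 -> \bar R :=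
  pushforward (@lebesgue_measure R \x m)%E (@rV_cons n).

HB.instance Definition _ := Measure.copy lebesgue_step
  (measure_function_pushforward__canonical__measure_function_Measure
    (@lebesgue_measure R \x m)%E (@measurable_rV_cons n)).

Let lebesgue_step_sigma_finite : sigma_finite setT lebesgue_step.
Proof.
have /sigma_finiteP[F [TF ndF Foo]] := sigma_finiteT (@lebesgue_measure R).
have /sigma_finiteP[G [TG ndG Goo]] := sigma_finiteT m.
exists (fun k => @rV_uncons n @^-1` (F k `*` G k)).
  rewrite -preimage_bigcup -[LHS](preimage_setT (@rV_uncons n)).
  congr (_ @^-1` _); rewrite -setXTT TF TG predeqE => -[x y]; split.
    move=> [/= [i _ Fx] [j _ Gy]]; exists (maxn i j) => //; split.
    - by move: x Fx; exact/subsetPset/ndF/leq_maxl.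
    - by move: y Gy; exact/subsetPset/ndG/leq_maxr.
  by move=> [i _ []/= ? ?]; split; exists i.
move=> k; have [mF Fk] := Foo k; have [mG Gk] := Goo k; split.
  rewrite -[X in measurable X]setTI; apply: measurable_rV_uncons => //.
  exact: measurableX.
rewrite /lebesgue_step /pushforward -comp_preimage.
rewrite (_ : _ \o _ = id) ?preimage_id; last first.
  by apply/funext => p /=; rewrite rV_consK.
by rewrite product_measure1E// lte_mul_pinfty// ge0_fin_numE.
Qed.

HB.instance Definition _ := Measure_isSigmaFinite.Build _ _ _ lebesgue_step
  lebesgue_step_sigma_finite.

End Step.

Fixpoint lebesgue_rV n : {sigma_finite_measure set 'rV[R]_n -> \bar R} :=
  match n with
  | 0 => \d_(0 : 'rV[R]_0)
  | n.+1 => lebesgue_step (lebesgue_rV n)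
  end.

End LebesgueMeasure.

Section DifferentialForms.
Context {R : realType} {n : nat}.
Implicit Types (k l : nat) (i : 'I_n) (S : {set 'I_n}) (x : 'rV[R]_n).

(* The sets S = {a_1 < ... < a_k} index the basis dx^{a_1} /\ ... /\ dx^{a_k}
   of the alternating k-forms on R^n, so an alternating form is the family of
   its coefficients. *)
Definition ksubset k := {S : {set 'I_n} | #|S| == k}.

Definition altform k := {ffun ksubset k -> R}.

Definition form k := 'rV[R]_n -> altform k.

Definition coef k (w : altform k) S : R :=
  if insub S is Some s then w s else 0.

(* The sign with dx^i /\ dx^{S :\ i} = ins_sign i S * dx^S for i in S, and
   dx^i /\ dx^S = ins_sign i S * dx^{i |: S} for i not in S. *)
Definition ins_sign i S : R := (-1) ^+ #|[set j in S | (j < i)%N]|.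

(* The sign with dx^S /\ dx^{~: S} = star_sign S * dx^1 /\ ... /\ dx^n. *)
Definition star_sign S : R :=
  (-1) ^+ #|[set p : 'I_n * 'I_n | [&& p.1 \in S, p.2 \notin S & (p.2 < p.1)%N]]|.

(* star dx^S = star_sign S * dx^{~: S}.  The operator is used only for
   k + l = n; taking l free avoids casts along n - (n - k) = k. *)
Definition hodge_star {k l} (w : form k) : form l := fun x =>
  [ffun s : ksubset l => star_sign (~: val s) * coef (w x) (~: val s)].

Definition koszul k (w : form k.+1) : form k := fun x =>
  [ffun s : ksubset k => \sum_(i | i \notin val s)
     ins_sign i (val s) * x ord0 i * coef (w x) (i |: val s)].

Definition pderiv i (f : 'rV[R]_n -> R) : 'rV[R]_n -> R :=
  fun x => 'D_(delta_mx ord0 i) f x.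

Definition extd k (w : form k) : form k.+1 := fun x =>
  [ffun s : ksubset k.+1 => \sum_(i in val s)
     ins_sign i (val s) * pderiv i (fun y => coef (w y) (val s :\ i)) x].

Fixpoint class_C (m : nat) (f : 'rV[R]_n -> R) : Prop :=
  continuous f /\
  if m is m'.+1 then
    forall i, (forall x, derivable f x (delta_mx ord0 i)) /\
              class_C m' (pderiv i f)
  else True.

Definition smooth_form k (w : form k) :=
  forall (s : ksubset k) (m : nat), class_C m (fun x => w x s).

Definition P0 (k : nat) : set (form k) := range (fun (a : altform k) _ => a).

Definition P1minus k : set (form k) :=
  [set a \+ b | a in @P0 k & b in @koszul k @` @P0 k.+1].

Definition P1starminus k : set (form k) := @hodge_star (n - k)%N k @` @P1minus (n - k)%N.

End DifferentialForms.

Arguments altform : clear implicits.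
Arguments form : clear implicits.
Arguments P0 {R n} k.
Arguments P1minus {R n} k.
Arguments P1starminus {R n} k.

(* Elements of L^2 Lambda^k(Omega) are represented by Borel functions on R^n,
   of which only the values on Omega, up to null sets, are relevant: every set
   of forms below is stable under change of representative, so that equality
   of such sets is equality of the sets of classes.  Operators on L^2 are given
   by their graphs. *)
Section L2Forms.
Context {R : realType} {n : nat} (Omega : set 'rV[R]_n).
Local Notation mu := (@lebesgue_rV R n).
Local Notation form := (form R n).

Definition L2form k (w : form k) :=
  forall s, measurable_fun Omega (fun x => w x s) /\
            mu.-integrable Omega (fun x => ((w x s) ^+ 2)%:E).

Definition inner k (v w : form k) : R :=
  \sum_s \int[mu]_(x in Omega) (v x s * w x s).

Definition test_form k (w : form k) :=
  smooth_form w /\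
  exists K, [/\ compact K, K `<=` Omega & forall x, ~ K x -> w x = 0].

(* The graph of the codifferential of (k+1)-forms, in the weak sense. *)
Definition codiff k (eta : form k.+1) (nu : form k) :=
  [/\ L2form eta, L2form nu &
      forall phi : form k, test_form phi ->
        inner (extd phi) eta = inner phi nu].

Definition Hstar k : set (form k.+1) := [set eta | exists nu, codiff eta nu].

Definition graph_norm k (eta : form k.+1) (nu : form k) : R :=
  Num.sqrt (inner eta eta + inner nu nu).

Definition Hstar0 k : set (form k.+1) :=
  [set eta | exists2 nu, codiff eta nu &
     forall e : R, 0 < e -> exists phi psi,
       [/\ test_form phi, codiff phi psi &
           graph_norm (eta \- phi) (nu \- psi) < e]].

Definition opker k l (A : form k -> form l -> Prop) (D : set (form k)) :
  set (form k) := [set v | D v /\ A v (fun=> 0)].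

Definition oprange k l (A : form k -> form l -> Prop) (D : set (form k)) :
  set (form l) := [set w | exists2 v, D v & A v w].

(* Orthogonality makes the sum direct. *)
Definition orth_sum k (A B C : set (form k)) :=
  A = [set v \+ w | v in B & w in C] /\
  (forall v w, B v -> C w -> inner v w = 0).

End L2Forms.

Arguments codiff {R n} Omega {k} eta nu.
Arguments Hstar {R n} Omega k.
Arguments Hstar0 {R n} Omega k.

Section Meshes.
Context {R : realType} {n : nat}.

Definition hyperplane (a : 'rV[R]_n) (c : R) : set 'rV[R]_n :=
  [set x | \sum_i a ord0 i * x ord0 i = c].

(* Polyhedral: the boundary lies in finitely many hyperplanes.  This allows
   every polyhedron, Lipschitz or not, including cracked ones. *)
Definition bounded_polyhedral_domain (Omega : set 'rV[R]_n) :=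
  [/\ open Omega, connected Omega, Omega !=set0, bounded_set Omega &
      exists hs : seq ('rV[R]_n * R),
        (forall h, h \in hs -> h.1 != 0) /\
        closure Omega `\` Omega `<=`
          [set x | exists2 h, h \in hs & hyperplane h.1 h.2 x]].

(* Simplices are given by the matrix of their vertices, one per row. *)
Definition affinely_independent (v : 'M[R]_(n.+1, n)) :=
  row_free (\matrix_(i < n) (row (lift ord0 i) v - row ord0 v)).

Definition face (v : 'M[R]_(n.+1, n)) (S : {set 'I_n.+1}) : set 'rV[R]_n :=
  [set x | exists t : 'rV[R]_n.+1,
     [/\ forall i, 0 <= t ord0 i, \sum_i t ord0 i = 1,
         forall i, i \notin S -> t ord0 i = 0 & x = t *m v]].

Definition simplex (v : 'M[R]_(n.+1, n)) : set 'rV[R]_n := face v [set: 'I_n.+1].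

Definition cell (v : 'M[R]_(n.+1, n)) : set 'rV[R]_n := (simplex v)°.

(* The intersection of two cells is a common face; the empty face is
   face v set0.  The inclusion of the open cells in Omega follows from the
   covering condition unless Omega has cracks. *)
Definition simplicial_subdivision (Omega : set 'rV[R]_n) (I : finType)
    (T : I -> 'M[R]_(n.+1, n)) :=
  [/\ forall a, affinely_independent (T a),
      closure Omega = \bigcup_a simplex (T a),
      forall a, cell (T a) `<=` Omega,
      forall a b, a != b -> cell (T a) `&` cell (T b) = set0 &
      forall a b, exists S S',
        simplex (T a) `&` simplex (T b) = face (T a) S /\
        face (T a) S = face (T b) S'].

End Meshes.

Section PiecewiseForms.
Context {R : realType} {n : nat} (Omega : set 'rV[R]_n) {I : finType}.
Variable T : I -> 'M[R]_(n.+1, n).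
Local Notation mu := (@lebesgue_rV R n).
Local Notation form := (form R n).

(* The boundaries of the simplices are null sets, so conditions on the open
   cells are enough. *)
Definition piecewise k (V : set (form k)) : set (form k) :=
  [set w | L2form Omega w /\
     forall a, exists2 p, V p & w = p %[ae mu in cell (T a)]].

Definition dh k (w : form k) (w' : form k.+1) :=
  [/\ L2form Omega w, L2form Omega w' &
      forall a, exists p, [/\ smooth_form p, w = p %[ae mu in cell (T a)] &
                              w' = extd p %[ae mu in cell (T a)]]].

Definition Wstar k : set (form k.+1) :=
  piecewise (P1starminus k.+1) `&` Hstar Omega k.

Definition Wstar0 k : set (form k.+1) :=
  piecewise (P1starminus k.+1) `&` Hstar0 Omega k.

Definition nonconforming k (M : set (form k.+1)) : set (form k) :=
  [set w | piecewise (P1minus k) w /\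
     forall eta nu w', M eta -> codiff Omega eta nu -> dh w w' ->
       inner Omega w nu - inner Omega w' eta = 0].

Definition Wnc k : set (form k) := nonconforming (@Wstar0 k).

Definition Wnc0 k : set (form k) := nonconforming (@Wstar k).

End PiecewiseForms.

Arguments piecewise {R n} Omega {I} T {k} V.
Arguments dh {R n} Omega {I} T {k} w w'.
Arguments Wstar {R n} Omega {I} T k.
Arguments Wstar0 {R n} Omega {I} T k.
Arguments Wnc {R n} Omega {I} T k.
Arguments Wnc0 {R n} Omega {I} T k.

(* Main.v *)
(* On a cell, a Whitney form a + koszul b is determined by its mean and by its
   exterior derivative, a constant, and these two data are arbitrary.  Dually,
   for eta in W*_h the codifferential is constant on each cell (testing the weak
   codifferential against bump functions supported in a cell shows that it is
   the cellwise one), and it vanishes on a cell only where eta is constant.  So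
   <w, delta eta> - <d_h w, eta> depends only on (mean w, d_h w) and
   (mean eta, delta eta), and the nonconforming space is the full adjoint, over
   all data (mean w, d_h w), of the finite-dimensional relation formed by the
   data (mean eta, delta eta).  The four decompositions are the identities
   R(D^ad) + N(D) = everything = N(D^ad) + R(D) for this relation D and its
   adjoint D^ad: elements of N(D) come from piecewise constant eta, and an
   element of N(D^ad) is a piecewise constant w. *)
Require Import Defs.
From mathcomp Require Import all_boot all_order all_algebra.
From mathcomp Require Import all_classical all_reals all_analysis measurable_realfun.
From mathcomp Require Import ring lra.

Set Implicit Arguments.
Unset Strict Implicit.
Unset Printing Implicit Defensive.
Import Order.TTheory GRing.Theory Num.Theory.
Import numFieldNormedType.Exports.
Local Open Scope classical_set_scope.
Local Open Scope ring_scope.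

(** The data of [eta] form a relation and not an operator: on a subdivided interval, the continuous
    piecewise linear function with alternating values 1 and -1 at the nodes has mean zero on every
    cell and a nonzero derivative. The algebra is therefore done for a subspace of pairs, weighted
    by the volumes of the cells. Each half is an orthogonal projection; the half about R(D^ad) also
    has to solve an adjoint equation, and the projection makes its right-hand side admissible. Three
    properties of the dual space enter: its elements are piecewise in [P1starminus], it contains 0,
    and it is stable under linear combinations. So one argument serves both boundary conditions. The
    obstacle is that the operators are known only as graphs up to null sets. For the codifferential,
    the test forms are products of one-variable bumps, so that Fubini reduces their pairing with
    affine coefficients to integration by parts on the line. For [dh], the smooth representative on
    a cell is determined because functions that are continuous and agree almost everywhere on an
    open set agree on it. *)

(** * Linear algebra of a relation between two weighted finite-dimensional spaces *)

(** The columns of [(kermx B^T)^T] span the null space of [B], and a row space is the annihilator of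
    its null space: one inclusion is clear and the ranks agree. This is the Fredholm alternative
    behind the adjoint equation. *)
Lemma submx_ker_trmx (F : fieldType) m p q (A : 'M[F]_(m, q)) (B : 'M[F]_(p, q)) :
  A *m (kermx B^T)^T = 0 -> (A <= B)%MS.
Proof.
move=> AB0; have /sub_kermxP leA := AB0; apply: submx_trans leA _.
have leB : (B <= kermx (kermx B^T)^T)%MS.
  have /(congr1 trmx) := mulmx_ker B^T.
  by rewrite trmx_mul trmxK trmx0 => /sub_kermxP.
suff -> : (kermx (kermx B^T)^T <= B)%MS = ((B == kermx (kermx B^T)^T)%MS).
  rewrite -(mxrank_leqif_eq leB) mxrank_ker mxrank_tr mxrank_ker mxrank_tr.
  by rewrite subKn// rank_leq_col.
by rewrite leB.
Qed.

(** [u *m K] is the projection of [v] on the row space of [K] for the weights [d]. By positivity the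
    row space meets its weighted orthogonal complement only in 0, and the two ranks add up to
    [p]. *)
Lemma mx_orthogonal_projection (F : realFieldType) m p (K : 'M[F]_(m, p))
    (d : 'rV[F]_p) (v : 'rV[F]_p) : (forall j, 0 < d 0 j) ->
  exists u : 'rV_m, (v - u *m K) *m diag_mx d *m K^T = 0.
Proof.
move=> d0; set D := diag_mx d.
have Dfree : row_free D.
  rewrite row_free_unit unitmxE det_diag unitfE.
  by apply/prodf_neq0 => j _; rewrite gt_eqF.
(* A common vector [w] satisfies [w *m D *m w^T = 0], a sum of squares with positive weights. *)
have cap0 : (K :&: kermx (D *m K^T) = 0)%MS.
  apply/eqP/rowV0P => w; rewrite sub_capmx => /andP[/submxP[u ->] /sub_kermxP].
  rewrite mulmxA => /(congr1 (mulmx^~ u^T)); rewrite mul0mx -mulmxA -trmx_mul.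
  set w' := u *m K => /matrixP/(_ 0 0); rewrite !mxE => sw.
  apply/rowP => j; rewrite [RHS]mxE; apply/eqP; rewrite -sqrf_eq0.
  have sw0 : \sum_j d 0 j * w' 0 j ^+ 2 = 0.
    rewrite -[RHS]sw; apply: eq_bigr => i _.
    by rewrite mul_mx_diag !mxE mulrAC -mulrA mulrC mulrA -expr2 mulrC.
  move/eqP: sw0; rewrite psumr_eq0 => [/allP/(_ j)|i _]; last first.
    by rewrite mulr_ge0 ?sqr_ge0// ltW.
  by rewrite mem_index_enum mulf_eq0 gt_eqF//= => /(_ isT).
have full : row_full (K + kermx (D *m K^T))%MS.
  rewrite /row_full mxrank_disjoint_sum// mxrank_ker.
  have -> : \rank (D *m K^T) = \rank K.
    by rewrite -mxrank_tr trmx_mul trmxK tr_diag_mx mxrankMfree.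
  by rewrite subnKC// rank_leq_col.
have /sub_addsmxP[[u w] /= vE] : (v <= K + kermx (D *m K^T))%MS.
  exact: submx_full.
exists u; rewrite vE addrAC subrr add0r -mulmxA.
by rewrite -[LHS]mulmxA mulmx_ker mulmx0.
Qed.

(** The subspace is only a predicate, so [K] is taken of maximal rank among the matrices whose row
    space lies in [S]. A vector of [S] outside that row space could be added to [K] and would raise
    the rank. *)
Lemma subspace_mx (F : fieldType) p (S : set 'rV[F]_p) :
  S 0 -> (forall c u v, S u -> S v -> S (c *: u + v)) ->
  exists K : 'M[F]_p, forall v, S v <-> (v <= K)%MS.
Proof.
move=> S0 SD.
pose good k := `[< exists K : 'M[F]_p, \rank K = k /\ forall v, (v <= K)%MS -> S v >].
have good0 : exists k, good k.
  exists 0%N; apply/asboolP; exists 0; split; first by rewrite mxrank0.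
  by move=> v; rewrite submx0 => /eqP->.
have goodp k : good k -> (k <= p)%N.
  by move=> /asboolP[K [<- _]]; exact: rank_leq_col.
case: (ex_maxnP good0 goodp) => k /asboolP[K [rK KS]] kmax.
exists K => v; split=> [Sv|]; last exact: KS.
apply/negP => /negP vK.
have : good (\rank (K + v)%MS).
  apply/asboolP; exists (K + v)%MS; split=> // w /sub_addsmxP[[u x] /= ->].
  have [c ->] : exists c, x *m v = c *: v.
    by exists (x 0 0); rewrite [x in LHS]mx11_scalar mul_scalar_mx.
  by rewrite addrC; apply: SD => //; apply: KS; exact: submxMl.
move/kmax; rewrite leqNgt -rK => /negP; apply.
rewrite ltn_neqAle mxrankS ?addsmxSl// andbT.
apply: contra vK => /eqP rKv.
have := mxrank_leqif_sup (addsmxSl K v).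
rewrite /leqif rKv eqxx => -[_ /esym KvK].
by apply: submx_trans KvK; exact: addsmxSr.
Qed.

(* Reading M a b as a = D b, the first claim says that R(D^ad) + N(D) is the whole
   space, the second that N(D^ad) + R(D) is, where D^ad is the adjoint of D for
   the inner products with weights wJ and wL. *)
Lemma linear_relation_decomposition (F : realFieldType) (J L : finType)
    (wJ : J -> F) (wL : L -> F) (M : (J -> F) -> (L -> F) -> Prop) :
  (forall j, 0 < wJ j) -> (forall l, 0 < wL l) ->
  M (fun=> 0) (fun=> 0) ->
  (forall c a b a' b', M a b -> M a' b' ->
     M (fun j => c * a j + a' j) (fun l => c * b l + b' l)) ->
  (forall b, exists a b2, M (fun=> 0) b2 /\ forall a' b', M a' b' ->
     \sum_j wJ j * a j * a' j = \sum_l wL l * (b l - b2 l) * b' l) /\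
  (forall a, exists a2 b2, M a2 b2 /\ forall a' b', M a' b' ->
     \sum_j wJ j * (a j - a2 j) * a' j = 0).
Proof.
move=> wJ0 wL0 M0 MD.
pose fJ (r : 'rV[F]_#|J|) : J -> F := fun j => r 0 (enum_rank j).
pose fL (r : 'rV[F]_#|L|) : L -> F := fun j => r 0 (enum_rank j).
pose rJ (f : J -> F) : 'rV[F]_#|J| := \row_i f (enum_val i).
pose rL (f : L -> F) : 'rV[F]_#|L| := \row_i f (enum_val i).
have rJK f : fJ (rJ f) = f by apply/funext => j; rewrite /fJ mxE enum_rankK.
have rLK f : fL (rL f) = f by apply/funext => j; rewrite /fL mxE enum_rankK.
have sumJ x y : \sum_j wJ j * fJ x j * fJ y j = (x *m diag_mx (rJ wJ) *m y^T) 0 0.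
  rewrite mxE (reindex (@enum_rank J)) /=; last exact/onW_bij/enum_rank_bij.
  by apply: eq_bigr => j _; rewrite mul_mx_diag !mxE enum_rankK [wJ j * _]mulrC.
have sumL x y : \sum_j wL j * fL x j * fL y j = (x *m diag_mx (rL wL) *m y^T) 0 0.
  rewrite mxE (reindex (@enum_rank L)) /=; last exact/onW_bij/enum_rank_bij.
  by apply: eq_bigr => j _; rewrite mul_mx_diag !mxE enum_rankK [wL j * _]mulrC.
(* The relation becomes a subspace of rows of length [#|J| + #|L|]. Once it is generated by
   [K = row_mx P Q], its elements are the pairs [(u *m P, u *m Q)]. *)
pose S : set 'rV[F]_(#|J| + #|L|) := [set r | M (fJ (lsubmx r)) (fL (rsubmx r))].
have [K SK] : exists K : 'M[F]_(#|J| + #|L|), forall v, S v <-> (v <= K)%MS.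
  apply: subspace_mx.
    have fJ0 : fJ (lsubmx (0 : 'rV_(#|J| + #|L|))) = (fun=> 0).
      by apply/funext => j; rewrite /fJ !mxE.
    have fL0 : fL (rsubmx (0 : 'rV_(#|J| + #|L|))) = (fun=> 0).
      by apply/funext => j; rewrite /fL !mxE.
    by rewrite /S /= fJ0 fL0.
  move=> c u v Su Sv; rewrite /S /=.
  have -> : fJ (lsubmx (c *: u + v)) =
      (fun j => c * fJ (lsubmx u) j + fJ (lsubmx v) j).
    by apply/funext => j; rewrite /fJ !mxE.
  have -> : fL (rsubmx (c *: u + v)) =
      (fun j => c * fL (rsubmx u) j + fL (rsubmx v) j).
    by apply/funext => j; rewrite /fL !mxE.
  exact: MD.
pose P := lsubmx K; pose Q := rsubmx K.
have MK a b : M a b <-> exists u, rJ a = u *m P /\ rL b = u *m Q.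
  have -> : M a b <-> S (row_mx (rJ a) (rL b)).
    by rewrite /S /= row_mxKl row_mxKr rJK rLK.
  rewrite SK; split=> [/submxP[u uE]|[u [aE bE]]].
    by exists u; move: uE; rewrite -[K]hsubmxK mul_mx_row => /eq_row_mx[-> ->].
  by rewrite aE bE -mul_mx_row hsubmxK submxMl.
have dJ0 j : 0 < rJ wJ 0 j by rewrite mxE.
have dL0 j : 0 < rL wL 0 j by rewrite mxE.
split=> [b|a].
  (* The rows of [kermx P *m Q] span the [b] that are related to 0. What remains of [b] after
     subtracting its projection [b2] is orthogonal to them, which is the solvability condition of
     the equation for [a] below. *)
  have [x xE] := mx_orthogonal_projection (kermx P *m Q) (rL b) dL0.
  set b2 := x *m _ in xE.
  have [a aE] : exists a, a *m (diag_mx (rJ wJ) *m P^T) =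
      (rL b - b2) *m diag_mx (rL wL) *m Q^T.
    have Du : diag_mx (rJ wJ) \in unitmx.
      rewrite unitmxE det_diag unitfE.
      by apply/prodf_neq0 => j _; rewrite gt_eqF.
    have /submxP[a aE] : ((rL b - b2) *m diag_mx (rL wL) *m Q^T <= P^T)%MS.
      apply: submx_ker_trmx; rewrite trmxK -[RHS]xE.
      by rewrite (trmx_mul (kermx P)) !mulmxA.
    by exists (a *m invmx (diag_mx (rJ wJ))); rewrite mulmxA mulmxKV.
  exists (fJ a), (fL b2); split.
    apply/MK; exists (x *m kermx P); split.
      by rewrite -mulmxA mulmx_ker mulmx0; apply/rowP => j; rewrite !mxE.
    rewrite -mulmxA -/b2; apply/rowP => j; rewrite mxE /fL enum_valK//.
  move=> a' b' /MK[u [a'E b'E]].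
  rewrite -[a' in LHS]rJK sumJ -[b' in RHS]rLK.
  rewrite (eq_bigr (fun l => wL l * fL (rL b - b2) l * fL (rL b') l)); last first.
    by move=> l _; rewrite /fL !mxE !enum_rankK.
  rewrite sumL a'E b'E !trmx_mul.
  by rewrite !mulmxA -[a *m _ *m _]mulmxA aE.
have [x xE] := mx_orthogonal_projection P (rJ a) dJ0.
exists (fJ (x *m P)), (fL (x *m Q)); split.
  by apply/MK; exists x; split; apply/rowP => j; rewrite mxE /fJ /fL enum_valK.
move=> a' b' /MK[u [a'E _]].
rewrite -[a' in LHS]rJK.
rewrite (eq_bigr (fun l => wJ l * fJ (rJ a - x *m P) l * fJ (rJ a') l)); last first.
  by move=> l _; rewrite /fJ !mxE !enum_rankK.
by rewrite sumJ a'E trmx_mul mulmxA xE mul0mx mxE.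
Qed.

(** * Integrals of real-valued functions and null sets *)

Section RealIntegrable.
Context d (T : measurableType d) (R : realType) (mu : {measure set T -> \bar R}).
Context (D : set T) (mD : measurable D).
Implicit Types f g : T -> R.

Lemma integrableZl_EFin c f : mu.-integrable D (EFin \o f) ->
  mu.-integrable D (EFin \o (fun x => c * f x)).
Proof. by move=> fi; exact: (integrableZl mD c fi). Qed.

Lemma integrableD_EFin f g : mu.-integrable D (EFin \o f) ->
  mu.-integrable D (EFin \o g) -> mu.-integrable D (EFin \o (fun x => f x + g x)).
Proof. by move=> fi gi; exact: (integrableD mD fi gi). Qed.

Lemma eq_integrable_EFin f g : (forall x, D x -> f x = g x) ->
  mu.-integrable D (EFin \o f) -> mu.-integrable D (EFin \o g).
Proof.
by move=> fg; apply: eq_integrable => // x /set_mem Dx; rewrite /= fg.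
Qed.

End RealIntegrable.

Lemma Rintegral_sum d (T : measurableType d) (R : realType)
    (mu : {measure set T -> \bar R}) (D : set T) (I : Type) (s : seq I) (P : pred I)
    (F : I -> T -> R) : measurable D ->
  (forall i, P i -> mu.-integrable D (EFin \o F i)) ->
  mu.-integrable D (EFin \o (fun x => \sum_(i <- s | P i) F i x)) /\
  \int[mu]_(x in D) (\sum_(i <- s | P i) F i x) =
  \sum_(i <- s | P i) \int[mu]_(x in D) F i x.
Proof.
move=> mD iF; elim: s => [|i s [iS IS]].
  split.
    by under [X in EFin \o X]eq_fun do rewrite big_nil; exact: integrable0.
  by under eq_Rintegral do rewrite big_nil; rewrite big_nil Rintegral_cst// mul0r.
under [X in EFin \o X]eq_fun do rewrite big_cons.
under eq_Rintegral do rewrite big_cons.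
rewrite big_cons; case: ifPn => // Pi; split.
  by apply: integrableD_EFin => //; exact: iF.
by rewrite RintegralD ?IS//; exact: iF.
Qed.

Lemma negligible_bigcup_countable d (T : measurableType d) (R : realType)
    (mu : {measure set T -> \bar R}) (I : countType) (F : I -> set T) :
  (forall i, mu.-negligible (F i)) -> mu.-negligible (\bigcup_i F i).
Proof.
move=> F0; pose G k := if unpickle k is Some i then F i else set0.
apply: (@negligibleS _ _ _ mu (\bigcup_k G k)).
  by move=> x [i _ Fix]; exists (pickle i) => //; rewrite /G pickleK.
apply: negligible_bigcup => k; rewrite /G.
by case: unpickle => [i|]; [exact: F0|exact: negligible_set0].
Qed.

(** * Lebesgue measure on row vectors: products, boxes, open sets, hyperplanes *)

Section LebesgueMeasureRowVectors.
Context {R : realType}.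
Local Notation leb := (@lebesgue_measure R).

Lemma rV_consE n (a : R) (v : 'rV[R]_n) :
  (rV_cons (a, v) ord0 ord0 = a) * (forall i, rV_cons (a, v) ord0 (lift ord0 i) = v ord0 i).
Proof.
have := rV_consK (a, v); rewrite /rV_uncons => -[-> /rowP v'].
by split=> // i; have := v' i; rewrite mxE.
Qed.

Lemma ge0_integral_rV_cons n (f : 'rV[R]_n.+1 -> \bar R) :
  measurable_fun setT f -> (forall x, 0 <= f x)%E ->
  (\int[lebesgue_rV n.+1]_x f x =
   \int[leb]_a \int[lebesgue_rV n]_v f (rV_cons (a, v)))%E.
Proof.
move=> mf f0.
rewrite [LHS](ge0_integral_pushforward (@measurable_rV_cons R n))//.
rewrite preimage_setT fubini_tonelli1//.
  by apply: measurableT_comp => //; exact: measurable_rV_cons.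
by move=> x; exact: f0.
Qed.

Lemma integral_rV0 (f : 'rV[R]_0 -> \bar R) :
  (\int[lebesgue_rV 0]_x f x = f 0%R)%E.
Proof.
have -> : f = cst (f 0) by apply/funext => x /=; rewrite [x]thinmx0.
by rewrite integral_cst//= diracT mule1.
Qed.

Lemma measurable_rV0 d (S : measurableType d) (f : 'rV[R]_0 -> S) :
  measurable_fun setT f.
Proof.
have -> : f = cst (f 0) by apply/funext => x /=; rewrite [x]thinmx0.
exact: measurable_cst.
Qed.

(** Splitting off the first coordinate, Tonelli bounds the integral of the absolute value and Fubini
    then gives the value. The bump functions are chosen as products so that their integrals reduce
    to the line through this lemma. *)
Lemma integrable_rV_prod n (g : 'I_n -> R -> R) :
  (forall i, leb.-integrable setT (EFin \o g i)) ->
  (lebesgue_rV n).-integrable setT (EFin \o (fun x : 'rV[R]_n => \prod_i g i (x ord0 i))) /\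
  \int[lebesgue_rV n]_x (\prod_i g i (x ord0 i)) = \prod_i \int[leb]_t g i t.
Proof.
elim: n g => [|n IH] g ig.
  split.
    apply/integrableP; split; first exact: measurable_rV0.
    by rewrite integral_rV0 ltry.
  by rewrite /Rintegral integral_rV0/= !big_ord0.
pose g' i := g (lift ord0 i).
have [iG IG] := IH g' (fun i => ig _).
pose G (v : 'rV[R]_n) := \prod_i g' i (v ord0 i).
have FE (a : R) (v : 'rV[R]_n) :
    \prod_i g i (rV_cons (a, v) ord0 i) = g ord0 a * G v.
  rewrite big_ord_recl !rV_consE; congr (_ * _).
  by apply: eq_bigr => i _; rewrite rV_consE.
have mF : measurable_fun setT (fun x : 'rV[R]_n.+1 => \prod_i g i (x ord0 i)).
  apply: measurable_prod => i _.
  apply: (measurableT_comp (f := g i) (g := coords i)); last exact: measurable_coords.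
  by apply/measurable_EFinP; exact: measurable_int (ig i).
have ifG : (\int[leb]_a \int[lebesgue_rV n]_v `|(g ord0 a * G v)%:E| < +oo)%E.
  rewrite (_ : (fun=> _) = (fun a => `|g ord0 a|%:E *
     \int[lebesgue_rV n]_v `|(G v)%:E|)%E); last first.
    apply/funext => a; rewrite -ge0_integralZl//.
    - by apply: eq_integral => v _; rewrite /= normrM.
    - by apply: measurableT_comp => //; exact: measurable_int iG.
  have [_ Goo] := integrableP _ _ _ iG.
  have [mg goo] := integrableP _ _ _ (ig ord0).
  rewrite ge0_integralZr//.
  - rewrite lte_mul_pinfty//.
    + exact: integral_ge0.
    + by rewrite ge0_fin_numE//; exact: integral_ge0.
  - by apply/measurable_EFinP/measurableT_comp => //; exact/measurable_EFinP.
  - exact: integral_ge0.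
have iF : (lebesgue_rV n.+1).-integrable setT
    (EFin \o (fun x : 'rV[R]_n.+1 => \prod_i g i (x ord0 i))).
  apply/integrableP; split; first exact/measurable_EFinP.
  rewrite ge0_integral_rV_cons.
  - by under eq_integral do under eq_integral do rewrite /= FE.
  - by apply: measurableT_comp => //; exact/measurable_EFinP.
  - by move=> x; exact: abse_ge0.
split=> //.
rewrite big_ord_recl -[in RHS]IG.
have iFp : (leb \x lebesgue_rV n)%E.-integrable setT
    ((EFin \o (fun x : 'rV[R]_n.+1 => \prod_i g i (x ord0 i))) \o @rV_cons R n).
  apply/integrable12ltyP.
    apply: measurableT_comp; last exact: measurable_rV_cons.
    exact/measurable_EFinP.
  by under eq_integral do under eq_integral do rewrite /= FE.
have -> : \int[lebesgue_rV n.+1]_x (\prod_i g i (x ord0 i)) =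
    fine (\int[leb]_a ((g ord0 a)%:E * \int[lebesgue_rV n]_v (G v)%:E))%E.
  congr fine; rewrite [LHS](integral_pushforward (@measurable_rV_cons R n))//; last first.
    exact/measurable_EFinP.
  rewrite preimage_setT -integral12_prod_meas1//; apply: eq_integral => a _.
  rewrite /fubini_F -integralZl//; apply: eq_integral => v _ /=.
  by rewrite FE EFinM.
rewrite -[(\int[lebesgue_rV n]_v (G v)%:E)%E]fineK; last exact: integrable_fin_num.
rewrite (integralZr measurableT (ig ord0)) fineM//.
  exact: integrable_fin_num (ig ord0).
Qed.

Definition box n (A : 'I_n -> set R) : set 'rV[R]_n := [set x | forall i, A i (x ord0 i)].

Definition obox n (a b : 'rV[R]_n) : set 'rV[R]_n :=
  box (fun i => `]a ord0 i, b ord0 i[%classic).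

Definition cbox n (a b : 'rV[R]_n) : set 'rV[R]_n :=
  box (fun i => `[a ord0 i, b ord0 i]%classic).

Lemma measurable_box n (A : 'I_n -> set R) :
  (forall i, measurable (A i)) -> measurable (box A).
Proof.
move=> mA; rewrite (_ : box A = \bigcap_(i in [set: 'I_n]) (coords i @^-1` A i)).
  apply: fin_bigcap_measurable => // i _.
  by rewrite -[X in measurable X]setTI; apply: measurable_coords => //; exact: mA.
by rewrite predeqE => x; split=> [Ax i _|Ax i]; [exact: Ax|exact: (Ax i)].
Qed.

Lemma indic_box n (A : 'I_n -> set R) (x : 'rV[R]_n) :
  \1_(box A) x = \prod_i \1_(A i) (x ord0 i) :> R.
Proof.
rewrite indicE; have [/set_mem xA|/negP xA] := boolP (x \in box A).
  by rewrite big1// => i _; rewrite indicE mem_set//; exact: xA.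
have [i xi] : exists i, ~ A i (x ord0 i).
  by apply/existsNP => xA'; apply: xA; apply/mem_set => i; exact: xA'.
by rewrite (bigD1 i)//= indicE memNset// mul0r.
Qed.

Lemma lebesgue_cbox n (a b : 'rV[R]_n) : (forall i, a ord0 i <= b ord0 i) ->
  lebesgue_rV n (cbox a b) = (\prod_i (b ord0 i - a ord0 i))%:E.
Proof.
move=> ab.
have [iF IF] := @integrable_rV_prod n
  (fun i => \1_(`[a ord0 i, b ord0 i]%classic)) (fun i => integrable_indic_itv _ _ _ _).
rewrite (_ : \prod_i _ = \prod_i \int[leb]_t \1_(`[a ord0 i, b ord0 i]%classic) t); last first.
  apply: eq_bigr => i _.
  rewrite /Rintegral integral_indic// setIT.
  transitivity (fine (leb `[a ord0 i, b ord0 i]%classic)); last by [].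
  rewrite lebesgue_measure_itv /= lte_fin.
  have := ab i; rewrite le_eqVlt => /predU1P[->|->//].
  by rewrite ltxx subrr.
rewrite -IF.
rewrite /Rintegral fineK; last exact: integrable_fin_num iF.
rewrite (eq_integral (fun x => (\1_(cbox a b) x)%:E)).
  by rewrite integral_indic ?setIT//; apply: measurable_box => i; exact: measurable_itv.
by move=> x _; rewrite indic_box.
Qed.

Lemma measurable_obox n (a b : 'rV[R]_n) : measurable (obox a b).
Proof. by apply: measurable_box => i; exact: measurable_itv. Qed.

Lemma measurable_cbox n (a b : 'rV[R]_n) : measurable (cbox a b).
Proof. by apply: measurable_box => i; exact: measurable_itv. Qed.

Lemma sub_obox_cbox n (a b : 'rV[R]_n) : obox a b `<=` cbox a b.
Proof. by move=> x xab i; have := xab i; apply: subset_itv_oo_cc. Qed.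

(** Rational corners make the union countable, hence [U] measurable for the coordinate
    sigma-algebra. The closed boxes are required to lie in [U] so that bumps on these boxes have
    compact support in [U]. *)
Lemma open_bigcup_obox n (U : set 'rV[R]_n) : open U ->
  U = \bigcup_(p in [set p : 'rV[rat]_n * 'rV[rat]_n |
        cbox (map_mx ratr p.1) (map_mx ratr p.2) `<=` U])
      obox (map_mx ratr p.1) (map_mx ratr p.2).
Proof.
move=> oU; rewrite eqEsubset; split=> [x Ux|x [p /= pU /sub_obox_cbox]]; last exact: pU.
have /nbhs_ballP[e /= e0 xeU] : nbhs x U by exact: open_nbhs_nbhs.
have /choice[q qP] : forall i, exists q : rat * rat,
    x ord0 i - e < ratr q.1 < x ord0 i /\ x ord0 i < ratr q.2 < x ord0 i + e.
  move=> i.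
  have /rat_in_itvoo[q1 q1P] : x ord0 i - e < x ord0 i by rewrite ltrBlDr ltrDl.
  have /rat_in_itvoo[q2 q2P] : x ord0 i < x ord0 i + e by rewrite ltrDl.
  by exists (q1, q2); move: q1P q2P; rewrite !in_itv.
exists (\row_i (q i).1, \row_i (q i).2) => /=.
  (* Balls of row vectors are taken entrywise, so a box whose corners are within [e] of [x] in each
     coordinate fits into the ball. *)
  move=> y xy; apply: xeU; split=> // i j; rewrite (ord1 i) /ball/=.
  have := xy j; have [/andP[q1 _] /andP[_ q2]] := qP j.
  rewrite /= in_itv/= !mxE => /andP[y1 y2].
  by rewrite ltr_norml ltrBrDl ltrBlDr; apply/andP; split; lra.
move=> i; have [/andP[_ q1] /andP[q2 _]] := qP i.
by rewrite /= in_itv/= !mxE q1 q2.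
Qed.

Lemma open_measurable_rV n (U : set 'rV[R]_n) : open U -> measurable U.
Proof.
move=> /open_bigcup_obox ->; rewrite bigcup_mkcond.
apply: countable_bigcupT_measurable => [|p]; first exact: countableP.
by case: ifP => // _; exact: measurable_obox.
Qed.

Lemma continuous_measurable_rV n (f : 'rV[R]_n -> R) :
  continuous f -> measurable_fun setT f.
Proof.
move=> /continuousP cf; apply: (measurability _ (RGenOpens.measurableE R)).
move=> _ [_ [a [b ->] <-]]; rewrite setTI; apply: open_measurable_rV.
exact/cf/interval_open.
Qed.

Lemma lebesgue_open_gt0 n (U : set 'rV[R]_n) : open U -> U !=set0 ->
  (0 < lebesgue_rV n U)%E.
Proof.
move=> oU [x]; rewrite {1}(open_bigcup_obox oU) => -[p pU xp].
set a := map_mx ratr p.1 in pU xp; set b := map_mx ratr p.2 in pU xp.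
have ab i : a ord0 i < b ord0 i.
  by have := xp i; rewrite /= in_itv/= => /andP[]; exact: lt_trans.
apply: (@lt_le_trans _ _ (lebesgue_rV n (cbox a b))).
  rewrite lebesgue_cbox => [|i]; last exact: ltW.
  by rewrite lte_fin prodr_gt0// => i _; rewrite subr_gt0.
by apply: le_measure pU; apply/mem_set; [exact: measurable_cbox|exact: open_measurable_rV].
Qed.

Lemma ler_coord_norm n (x : 'rV[R]_n) i : `|x ord0 i| <= `|x|.
Proof.
have -> : `|x| = \big[Order.max/0]_ij `|x ij.1 ij.2| by exact: mx_normrE.
exact: (le_bigmax _ (fun ij => `|x ij.1 ij.2|) (ord0, i)).
Qed.

Lemma lebesgue_bounded_lty n (A : set 'rV[R]_n) : measurable A -> bounded_set A ->
  (lebesgue_rV n A < +oo)%E.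
Proof.
move=> mA [M [_ /(_ (`|M| + 1)) AM]]; pose c : 'rV[R]_n := const_mx (`|M| + 1).
have {}AM : A `<=` cbox (- c) c.
  move=> x /AM; rewrite ltr_pwDr ?ler_norm// => /(_ isT) xM i.
  by rewrite /= in_itv/= !mxE -ler_norml; apply: le_trans xM; exact: ler_coord_norm.
apply: (@le_lt_trans _ _ (lebesgue_rV n (cbox (- c) c))).
  by apply: le_measure AM; apply/mem_set => //; exact: measurable_cbox.
rewrite lebesgue_cbox ?ltry// => i; rewrite !mxE.
by rewrite ge0_cp// addr_ge0.
Qed.

Lemma measurable_hyperplane n (a : 'rV[R]_n) c : measurable (hyperplane a c).
Proof.
rewrite (_ : hyperplane a c = (fun x : 'rV[R]_n => \sum_i a ord0 i * x ord0 i) @^-1` [set c])//.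
rewrite -[X in measurable X]setTI.
suff : measurable_fun setT (fun x : 'rV[R]_n => \sum_i a ord0 i * x ord0 i) by exact.
apply: measurable_sum => i; apply: measurable_funM => //.
exact: measurable_coords.
Qed.

(** Slice along the first coordinate. If the remaining coefficients [a'] are not all zero, every
    slice is a hyperplane of one dimension less. If [a' = 0], the slice at [t] is empty except at
    the single point [t = c / a ord0 ord0]. *)
Lemma lebesgue_hyperplane n (a : 'rV[R]_n) c : a != 0 ->
  lebesgue_rV n (hyperplane a c) = 0.
Proof.
elim: n a c => [a c|n IH a c a0].
  by rewrite [a]thinmx0 eqxx.
have -> : lebesgue_rV n.+1 (hyperplane a c) =
  (\int[leb]_t lebesgue_rV n (xsection (@rV_cons R n @^-1` hyperplane a c) t))%E by [].
pose a' : 'rV[R]_n := \row_i a ord0 (lift ord0 i).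
have xE t : xsection (@rV_cons R n @^-1` hyperplane a c) t =
    hyperplane a' (c - a ord0 ord0 * t).
  rewrite predeqE => v; rewrite /xsection/= inE /hyperplane/=.
  have -> : \sum_i a ord0 i * rV_cons (t, v) ord0 i =
      a ord0 ord0 * t + \sum_i a' ord0 i * v ord0 i.
    rewrite big_ord_recl rV_consE; congr (_ + _).
    by apply: eq_bigr => i _; rewrite rV_consE mxE.
  by split=> [<-|->]; [rewrite addrC addKr|rewrite addrC subrK].
under eq_integral do rewrite xE.
have [a'0|a'0] := eqVneq a' 0; last first.
  by rewrite integral0_eq// => t _; exact: IH.
have a00 : a ord0 ord0 != 0.
  apply: contraNneq a0 => a00; apply/eqP/rowP => i; rewrite mxE.
  case: (unliftP ord0 i) => [j|] -> //.
  by have /rowP/(_ j) := a'0; rewrite !mxE.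
transitivity (\int[leb]_t (cst 0 t))%E; last exact: integral0.
apply: ae_eq_integral => //.
- have := @measurable_fun_xsection _ _ _ _ _ (lebesgue_rV n)
    (@rV_cons R n @^-1` hyperplane a c).
  rewrite (_ : _ \o _ = fun t => lebesgue_rV n (hyperplane a' (c - a ord0 ord0 * t))).
    apply; rewrite -[X in measurable X]setTI.
    exact: (measurable_rV_cons measurableT (measurable_hyperplane a c)).
  by apply/funext => t /=; rewrite xE.
exists [set c / a ord0 ord0]; split; [exact: measurable_set1|exact: lebesgue_measure_set1|].
move=> t /=; apply: contra_notP => tc _.
rewrite a'0 (_ : hyperplane _ _ = set0) ?measure0// -subset0 => v.
rewrite /hyperplane/= big1 => [/esym/eqP|i _]; last by rewrite mxE mul0r.
rewrite subr_eq0 => /eqP ctE; apply: tc.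
by rewrite ctE mulrAC divff ?mul1r.
Qed.

End LebesgueMeasureRowVectors.

(** * Smooth bump functions of one variable *)

Section FlatFunctions.
Context {R : realType}.
Local Notation leb := (@lebesgue_measure R).

(* The derivatives of exp(-1/t), extended by 0 to t <= 0, are of this form. *)
Definition flat (p : {poly R}) (t : R) : R :=
  if 0 < t then p.[t^-1] * expR (- t^-1) else 0.

Lemma expR_ge_Xfact (x : R) n : 0 <= x -> x ^+ n <= n`!%:R * expR x.
Proof.
move=> x0; case: n => [|n]; first by rewrite expr0 mul1r -expR0 ler_expR.
rewrite mulrC -ler_pdivrMr ?ltr0n ?fact_gt0//.
by apply: le_trans (expR_ge1Dxn n x0); rewrite lerDr.
Qed.

(** Each power of [t^-1] is at most a factorial times [expR t^-1], being one term of the exponential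
    series, so the exponential absorbs the polynomial uniformly in [t]. *)
Lemma flat_bounded p : exists C, forall t, `|flat p t| <= C.
Proof.
exists (\sum_(i < size p) `|p`_i| * i`!%:R) => t; rewrite /flat.
case: ifPn => t0; last by rewrite normr0 sumr_ge0// => i _; rewrite mulr_ge0.
rewrite normrM (ger0_norm (expR_ge0 _)) expRN ler_pdivrMr ?expR_gt0//.
rewrite horner_coef (le_trans (ler_norm_sum _ _ _))// mulr_suml ler_sum// => i _.
rewrite normrM -mulrA ler_wpM2l// ger0_norm ?exprn_ge0 ?invr_ge0 ?(ltW t0)//.
by apply: expR_ge_Xfact; rewrite invr_ge0 ltW.
Qed.

(** A factor ['X] in the polynomial is a factor [t^-1], so every [flat p] is [t] times a bounded
    function of the same family. This settles both continuity and differentiability at 0. *)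
Lemma flatMX p t : flat p t = t * flat ('X * p) t.
Proof.
rewrite /flat; case: ifPn => t0; last by rewrite mulr0.
by rewrite hornerM hornerX !mulrA divff ?mul1r// gt_eqF.
Qed.

Lemma flat_continuous0 p : {for 0, continuous (flat p)}.
Proof.
have [C pC] := flat_bounded ('X * p).
have C0 : 0 <= C by apply: le_trans (pC 0).
have p0 : flat p 0 = 0 by rewrite /flat ltxx.
apply/cvgrPdist_le => e e0; near=> t.
rewrite p0 sub0r normrN flatMX normrM.
apply: (@le_trans _ _ (`|t| * (C + 1))).
  by rewrite ler_wpM2l// (le_trans (pC _))// lerDl.
rewrite -ler_pdivlMr ?ltr_wpDl//.
near: t; apply/nbhs_ballP; exists (e / (C + 1)) => /=.
  by rewrite divr_gt0// ltr_wpDl.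
by move=> y; rewrite /ball/= sub0r normrN => /ltW.
Unshelve. all: end_near. Qed.

Lemma is_derive_flat p t :
  is_derive (t : R) (1 : R) (flat p) (flat ('X^2 * (p - p^`())) t).
Proof.
have [t0|t0|->] := ltgtP t 0.
- have -> : flat ('X^2 * (p - p^`())) t = 0 by rewrite /flat ltNge (ltW t0).
  apply: (@near_eq_is_derive _ _ _ (cst 0)).
    near=> x; rewrite /flat ifF//; apply/negbTE; rewrite -leNgt ltW//.
    by near: x; apply: open_nbhs_nbhs; split => //; exact: open_lt.
- apply: (@near_eq_is_derive _ _ _ (fun x : R => p.[x^-1] * expR (- x^-1))).
    near=> x; rewrite /flat ifT//.
    by near: x; apply: open_nbhs_nbhs; split => //; exact: open_gt.
  have t_neq0 : t != 0 by rewrite gt_eqF.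
  have dV : is_derive (t : R) (1 : R) (fun x : R => x^-1) (- t ^- 2).
    have := @is_deriveV R id t 1 1 t_neq0 (is_derive_id _ _).
    by rewrite /GRing.scale/= mulr1.
  have dp : is_derive (t : R) (1 : R) (fun x : R => p.[x^-1]) (p^`().[t^-1] * (- t ^- 2)).
    exact: (@is_derive1_comp _ (horner p) (fun x => x^-1)).
  have de : is_derive (t : R) (1 : R) (fun x : R => expR (- x^-1)) (expR (- t^-1) * (t ^- 2)).
    apply: (@is_derive1_comp _ expR (fun x => - x^-1)).
    by rewrite -[t ^- 2]opprK; exact: is_deriveN.
    refine (@is_derive_eq _ _ _ _ _ _ _ _ (is_deriveM dp de) _).
  rewrite /GRing.scale/= /flat t0 !hornerE -!exprVn /=; ring.
(* By [flatMX] the difference quotient of [flat p] at 0 is [flat ('X * p)], which is continuous at 0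
   with value 0. *)
- apply/is_derive1_caratheodory; exists (flat ('X * p)); split.
  + by move=> z; rewrite subr0 /(flat p 0) /flat ltxx subr0 -/(flat p z) flatMX mulrC.
  + exact: flat_continuous0.
  + by rewrite /flat ltxx.
Unshelve. all: end_near. Qed.

(** One class closed under differentiation witnesses the derivatives of all orders at once, so no
    iterated derivative has to be written down. *)
Definition smooth1 (f : R -> R) :=
  exists2 S : set (R -> R), S f &
    forall g, S g -> exists2 g', S g' & forall t, is_derive (t : R) (1 : R) g (g' t).

Lemma smooth1_derive f : smooth1 f ->
  exists2 f', smooth1 f' & forall t, is_derive (t : R) (1 : R) f (f' t).
Proof.
by move=> [S Sf SD]; have [f' Sf' ff'] := SD _ Sf; exists f' => //; exists S.
Qed.

Lemma smooth1_continuous f : smooth1 f -> continuous f.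
Proof.
move=> /smooth1_derive[f' _ ff'] t.
by apply/differentiable_continuous/derivable1_diffP; have [] := ff' t.
Qed.

(** For [p = q = 1] and [k > 0] this is positive exactly on the interval; other polynomials appear
    in the derivatives. The scale [k] steepens the flanks: the bumps tend to the indicator of the
    interval, and this takes the place of mollification. *)
Definition bump2 (k a b : R) p q : R -> R :=
  fun t => flat p (k * (t - a)) * flat q (k * (b - t)).

Definition bump1 k a b : R -> R := bump2 k a b 1 1.

Lemma is_derive_bump2 k a b p q t :
  is_derive (t : R) (1 : R) (bump2 k a b p q)
    (k * bump2 k a b ('X^2 * (p - p^`())) q t + (- k) * bump2 k a b p ('X^2 * (q - q^`())) t).
Proof.
have d1 : is_derive (t : R) (1 : R) (fun t => flat p (k * (t - a)))
    (flat ('X^2 * (p - p^`())) (k * (t - a)) * k).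
  apply: (@is_derive1_comp _ (flat p)); first exact: is_derive_flat.
  have : is_derive (t : R) (1 : R) (k \*: (fun x : R => x - a)) (k *: (1 - 0 : R)).
    by apply: is_deriveZ; apply: is_deriveB.
  by rewrite subr0 /GRing.scale/= mulr1.
have d2 : is_derive (t : R) (1 : R) (fun t => flat q (k * (b - t)))
    (flat ('X^2 * (q - q^`())) (k * (b - t)) * - k).
  apply: (@is_derive1_comp _ (flat q)); first exact: is_derive_flat.
  have : is_derive (t : R) (1 : R) (k \*: (fun x : R => b - x)) (k *: (0 - 1 : R)).
    by apply: is_deriveZ; apply: is_deriveB.
  by rewrite sub0r /GRing.scale/= mulrN1.
refine (@is_derive_eq _ _ _ _ _ _ _ _ (is_deriveM d1 d2) _).
rewrite /GRing.scale/= /bump2; ring.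
Qed.

(** By the Leibniz rule in [is_derive_bump2] this span is closed under differentiation; it is the
    class that witnesses [smooth1] for the bumps. *)
Inductive bump_span k a b : (R -> R) -> Prop :=
| bump_span_gen p q : bump_span k a b (bump2 k a b p q)
| bump_span_lin c d f g : bump_span k a b f -> bump_span k a b g ->
    bump_span k a b (fun t => c * f t + d * g t).

Lemma smooth1_bump1 k a b : smooth1 (bump1 k a b).
Proof.
exists (bump_span k a b); first exact: bump_span_gen.
move=> g; elim=> [p q|c d f h _ [f' Sf' ff'] _ [h' Sh' hh']].
  eexists; last by move=> t; exact: is_derive_bump2.
  by apply: bump_span_lin; exact: bump_span_gen.
exists (fun t => c * f' t + d * h' t); first exact: bump_span_lin.
by move=> t; apply: is_deriveD; exact: is_deriveZ.
Qed.

Lemma bump1_ge0 k a b t : 0 <= bump1 k a b t.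
Proof.
rewrite /bump1 /bump2 mulr_ge0// /flat; case: ifP => // _.
  by rewrite hornerC mul1r expR_ge0.
by rewrite hornerC mul1r expR_ge0.
Qed.

Lemma flat1_le1 t : flat 1 t <= 1.
Proof.
rewrite /flat; case: ifP => // t0; rewrite hornerC mul1r -expR0 ler_expR.
by rewrite oppr_le0 invr_ge0 ltW.
Qed.

Lemma flat1_ge0 t : 0 <= flat 1 t.
Proof. by rewrite /flat; case: ifP => // t0; rewrite hornerC mul1r expR_ge0. Qed.

Lemma bump1_le1 k a b t : bump1 k a b t <= 1.
Proof. by rewrite mulr_ile1// ?flat1_ge0// flat1_le1. Qed.

Lemma bump2_out k a b p q t : 0 < k -> t \notin `]a, b[ -> bump2 k a b p q t = 0.
Proof.
move=> k0; rewrite in_itv/= negb_and -!leNgt /bump2 /flat => /orP[ta|bt].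
  by rewrite ifF ?mul0r// pmulr_rgt0// subr_gt0 ltNge ta.
by rewrite [X in _ * X]ifF ?mulr0// pmulr_rgt0// subr_gt0 ltNge bt.
Qed.

Lemma flat1_cvg t : 0 < t -> flat 1 (k.+1%:R * t) @[k --> \oo] --> (1 : R).
Proof.
move=> t0.
have -> : (fun k : nat => flat 1 (k.+1%:R * t)) = (fun k : nat => expR (- (t^-1 * k.+1%:R^-1))).
  apply/funext => k; rewrite /flat pmulr_rgt0// t0 hornerC mul1r invfM//.
  by rewrite mulrC.
rewrite -[in X in _ --> X]expR0; apply: continuous_cvg; first exact: continuous_expR.
rewrite -[in X in _ --> X]oppr0; apply: cvgN; rewrite -[in X in _ --> X](mulr0 t^-1).
by apply: cvgMr; exact: cvg_harmonic.
Qed.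

Lemma bump1_cvg a b t : bump1 k.+1%:R a b t @[k --> \oo] --> (\1_`]a, b[%classic t : R).
Proof.
rewrite indicE mem_setE; have [tab|tab] := boolP (t \in `]a, b[).
  rewrite /bump1 /bump2 -(mulr1 1%:R).
  move: tab; rewrite in_itv/= => /andP[at_ tb].
  by apply: cvgM; apply: flat1_cvg; rewrite subr_gt0.
under eq_fun do rewrite /bump1 bump2_out//.
exact: cvg_cst.
Qed.

Lemma continuous_compact_supp_integrable (f : R -> R) a b :
  continuous f -> (forall t, t \notin `[a, b] -> f t = 0) ->
  leb.-integrable setT (EFin \o f).
Proof.
move=> cf f0.
have : leb.-integrable `[a, b]%classic (EFin \o f).
  apply: continuous_compact_integrable; first exact: segment_compact.
  exact: continuous_subspaceT.
rewrite integrable_mkcond//; apply: eq_integrable => // t _.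
rewrite patchE mem_setE; case: ifPn => // tab.
by rewrite /= f0.
Qed.

Lemma Rintegral_derive_compact_supp (f f' : R -> R) a b : a < b ->
  (forall t, is_derive (t : R) (1 : R) f (f' t)) -> continuous f' ->
  (forall t, t \notin `]a, b[ -> f t = 0) ->
  leb.-integrable setT (EFin \o f') /\ \int[leb]_t f' t = 0.
Proof.
move=> ab ff' cf' f0.
have cf : continuous f.
  by move=> t; apply/differentiable_continuous/derivable1_diffP; have [] := ff' t.
have f'0 t : t \notin `[a, b] -> f' t = 0.
  move=> tab; have -> : f' t = 'D_1 f t by have [_ ->] := ff' t.
  have -> : 'D_1 f t = 'D_1 (cst 0 : R -> R) t.
    apply: near_eq_derive => //.
    have : nbhs t (~` `[a, b]%classic).
      apply: open_nbhs_nbhs; split; first by apply: closed_openC; exact: interval_closed.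
      by move/negP: tab.
    apply: filterS => x /= /negP xab; apply: f0; apply: contra xab.
    exact: subset_itv_oo_cc.
  by rewrite derive_cst.
split; first exact: continuous_compact_supp_integrable cf' f'0.
have : (\int[leb]_(t in `[a, b]) (f' t)%:E = (f b)%:E - (f a)%:E)%E.
  apply: continuous_FTC2 => //.
  - exact: continuous_subspaceT.
  - split.
    + by move=> x _; have [] := ff' x.
    + by apply: cvg_at_right_filter; exact: cf.
    + by apply: cvg_at_left_filter; exact: cf.
  - by move=> x _; rewrite derive1E; have [_ ->] := ff' x.
have fa : f a = 0 by apply: f0; rewrite in_itv/= ltxx.
have fb : f b = 0 by apply: f0; rewrite in_itv/= ltxx andbF.
rewrite fa fb sube0 => If'.
transitivity (fine (\int[leb]_(t in `[a, b]) (f' t)%:E)%E); last by rewrite If'.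
rewrite integral_mkcond.
congr fine; apply: eq_integral => t _.
rewrite patchE mem_setE; case: ifPn => // tab.
by rewrite f'0.
Qed.

Lemma bump1_derive k a b : 0 < k -> exists f', [/\ continuous f',
  forall t, is_derive (t : R) (1 : R) (bump1 k a b) (f' t) &
  forall t, t \notin `]a, b[ -> f' t = 0].
Proof.
move=> k0; have [f' /smooth1_continuous cf' bf'] := smooth1_derive (smooth1_bump1 k a b).
exists f'; split=> // t tab.
have [_ <-] := bf' t; have [_ ->] := is_derive_bump2 k a b 1 1 t.
by rewrite !bump2_out// !mulr0 addr0.
Qed.

End FlatFunctions.

(** * The fundamental lemma of the calculus of variations, tested on product bumps *)

Section FundamentalLemma.
Context {R : realType}.

Definition bumpn n (k : R) (a b x : 'rV[R]_n) : R :=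
  \prod_i bump1 k (a ord0 i) (b ord0 i) (x ord0 i).

Lemma bumpn_ge0 n k (a b x : 'rV[R]_n) : 0 <= bumpn k a b x.
Proof. by apply: prodr_ge0 => i _; exact: bump1_ge0. Qed.

Lemma bumpn_le1 n k (a b x : 'rV[R]_n) : bumpn k a b x <= 1.
Proof. by apply: prodr_ile1 => i; rewrite bump1_ge0 bump1_le1. Qed.

Lemma bumpn_out n k (a b x : 'rV[R]_n) : 0 < k -> ~ obox a b x -> bumpn k a b x = 0.
Proof.
move=> k0 /existsNP[i /negP xi].
by rewrite /bumpn (bigD1 i)//= [bump1 _ _ _ _]bump2_out ?mul0r.
Qed.

Lemma bumpn_cvg n (a b x : 'rV[R]_n) :
  bumpn k.+1%:R a b x @[k --> \oo] --> (\1_(obox a b) x : R).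
Proof.
rewrite indic_box /bumpn; apply: cvg_big => [|i _]; last exact: bump1_cvg.
by apply: mul_continuous.
Qed.

Lemma measurable_coord_comp n (g : R -> R) (i : 'I_n) : measurable_fun setT g ->
  measurable_fun setT (fun x : 'rV[R]_n => g (x ord0 i)).
Proof.
by move=> mg; apply: (measurableT_comp (f := g) (g := coords i)) => //;
  exact: measurable_coords.
Qed.

Lemma measurable_bumpn n k (a b : 'rV[R]_n) : measurable_fun setT (bumpn k a b).
Proof.
apply: measurable_prod => i _; apply: measurable_coord_comp.
apply: continuous_measurable_fun; apply: smooth1_continuous.
exact: smooth1_bump1.
Qed.

Lemma obox_setI n (a b a' b' : 'rV[R]_n) : obox a b `&` obox a' b' =
  obox (\row_i Num.max (a ord0 i) (a' ord0 i)) (\row_i Num.min (b ord0 i) (b' ord0 i)).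
Proof.
rewrite predeqE => x; split=> [[xa xb] i|xab].
  have := xa i; have := xb i; rewrite /= !in_itv/= !mxE gt_max lt_min.
  by move=> /andP[-> ->] /andP[-> ->].
by split=> i; have := xab i; rewrite /= !in_itv/= !mxE gt_max lt_min;
  move=> /andP[/andP[? ?] /andP[? ?]]; apply/andP.
Qed.

(** A coordinate strip is open, hence a countable union of rational boxes. So the coordinates are
    measurable for the sigma-algebra generated by the boxes, which must then contain the given
    one. *)
Lemma measurable_gen_obox n (A : set 'rV[R]_n) : measurable A ->
  (<<s [set obox p.1 p.2 | p in [set: 'rV[R]_n * 'rV[R]_n]] >>) A.
Proof.
set G := [set _ | _ in _] => mA.
pose S := g_sigma_algebraType G.
have mid : measurable_fun setT (id : S -> 'rV[R]_n).
  apply: measurable_fun_coordsP => i.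
  apply: (measurability _ (RGenOpens.measurableE R)) => _ [_ [x [y ->] <-]].
  rewrite setTI.
  have /open_bigcup_obox -> : open (coords i @^-1` `]x, y[%classic : set 'rV[R]_n).
    apply: open_comp; last exact: interval_open.
    by move=> z _; exact: coord_continuous.
  rewrite bigcup_mkcond; apply: (@countable_bigcupT_measurable _ S); first exact: countableP.
  move=> p; case: ifP => // _; apply: sub_sigma_algebra.
  by exists (map_mx ratr p.1, map_mx ratr p.2).
by have := mid measurableT A mA; rewrite setTI.
Qed.

(** The bumps at scale [k.+1] are bounded by 1 and tend to the indicator of the box, so dominated
    convergence with bound [|f|] passes from bumps to the box. *)
Lemma integral_obox0 n (U : set 'rV[R]_n) (f : 'rV[R]_n -> R) (a b : 'rV[R]_n) :
  open U -> (lebesgue_rV n).-integrable U (EFin \o f) ->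
  (forall (k : R) (a b : 'rV[R]_n), 0 < k -> (forall i, a ord0 i < b ord0 i) -> cbox a b `<=` U ->
     \int[lebesgue_rV n]_(x in U) (bumpn k a b x * f x) = 0) ->
  cbox a b `<=` U -> (\int[lebesgue_rV n]_(x in obox a b) (f x)%:E = 0)%E.
Proof.
move=> oU fi f0 abU; have mU := open_measurable_rV oU.
have [ab|/existsNP[i /negP abi]] := pselect (forall i, a ord0 i < b ord0 i); last first.
  rewrite (_ : obox a b = set0) ?integral_set0// -subset0 => x /(_ i).
  by rewrite /= in_itv/= => /andP[/lt_trans] /[apply]; apply/negP.
have mf : measurable_fun U f by apply/measurable_EFinP; exact: measurable_int fi.
have mfk k : measurable_fun U (fun x => bumpn k a b x * f x).
  by apply: measurable_funM => //; apply: measurable_funTS; exact: measurable_bumpn.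
have fki k : (lebesgue_rV n).-integrable U (EFin \o (fun x => bumpn k a b x * f x)).
  apply: le_integrable fi => //; first exact/measurable_EFinP.
  move=> x _ /=; rewrite lee_fin normrM ger0_norm ?bumpn_ge0//.
  by rewrite ler_piMl// bumpn_le1.
have [|||||_ _] := @dominated_convergence _ _ _ (lebesgue_rV n) U mU
  (fun k x => (bumpn k.+1%:R a b x * f x)%:E) (fun x => (\1_(obox a b) x * f x)%:E)
  (fun x => `|f x|%:E).
- by move=> k; exact: measurable_int (fki _).
- apply/measurable_EFinP; apply: measurable_funM => //.
  by apply: measurable_funTS; apply: measurable_indic; exact: measurable_obox.
- apply: aeW => x _; apply/cvg_EFin; first by near=> k.
  by apply: cvgMr_tmp; exact: bumpn_cvg.
- exact: integrable_abse fi.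
- apply: aeW => x k _; rewrite lee_fin normrM ger0_norm ?bumpn_ge0//.
  by rewrite ler_piMl// bumpn_le1.
have -> : [sequence (\int[lebesgue_rV n]_(x in U) (bumpn k.+1%:R a b x * f x)%:E)%E]_k =
    cst 0%E.
  apply/funext => k /=; rewrite -[LHS]fineK; last exact: integrable_fin_num (fki _).
  by congr EFin; exact: f0.
move=> lim.
transitivity (\int[lebesgue_rV n]_(x in U) (\1_(obox a b) x * f x)%:E)%E.
  rewrite -{1}(setIidr (subset_trans (@sub_obox_cbox _ _ a b) abU)) integral_mkcondr.
  apply: eq_integral => x _; rewrite patchE indicE.
  by case: ifP => _; rewrite ?mul1r ?mul0r.
by rewrite -(cvg_lim _ lim)// lim_cst.
Unshelve. all: end_near. Qed.

(** Boxes are stable under intersection and generate the measurable sets, so Dynkin's argument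
    extends the vanishing integrals from boxes to all of them. Sets are intersected with [B], where
    [f] is integrable; the integral over [B] itself accounts for the whole space and for
    complements. *)
Lemma ae_eq0_obox n (B : set 'rV[R]_n) (f : 'rV[R]_n -> R) :
  measurable B -> (lebesgue_rV n).-integrable B (EFin \o f) ->
  (\int[lebesgue_rV n]_(x in B) (f x)%:E = 0)%E ->
  (forall a b, (\int[lebesgue_rV n]_(x in B `&` obox a b) (f x)%:E = 0)%E) ->
  ae_eq (lebesgue_rV n) B f (cst 0).
Proof.
move=> mB fi fB fobox.
have mf : measurable_fun B f by apply/measurable_EFinP; exact: measurable_int fi.
suff : ae_eq (lebesgue_rV n) B (EFin \o f) (cst 0%E).
  by apply: filterS => x /[apply] -[].
pose H E := measurable E /\ (\int[lebesgue_rV n]_(x in B `&` E) (f x)%:E = 0)%E.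
have HP : dynkin H.
  split.
  - by split=> //; rewrite setIT.
  - move=> E [mE E0]; split; first exact: measurableC.
    have := fB; rewrite -[in X in X = _ -> _](setUIDK B E) integral_setU_EFin//=.
    - by rewrite E0 add0e setDE.
    - exact: measurableI.
    - exact: measurableD.
    - by rewrite setUIDK.
    - by apply/disj_setPS => x [[_ Ex] [_]].
  - move=> F tF HF; split.
      by apply: bigcup_measurable => k _; have [] := HF k.
    rewrite setI_bigcupr integral_bigcup//.
    + by rewrite eseries0// => k _ _; have [] := HF k.
    + by apply: trivIset_setIl.
    + by move=> k; apply: measurableI => //; have [] := HF k.
    + apply: integrableS fi => //.
        by apply: bigcup_measurable => k _; apply: measurableI => //; have [] := HF k.
      by move=> x [k _ []].
apply: integral_ae_eq => // E EB mE.
rewrite integral_cst//= mul0e.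
suff /(_ _ (measurable_gen_obox mE))[_] :
  <<s [set obox p.1 p.2 | p in [set: 'rV[R]_n * 'rV[R]_n]] >> `<=` H.
  by rewrite setIidr.
apply: lambda_system_subset => //.
- move=> _ _ [p _ <-] [q _ <-]; rewrite obox_setI.
  by eexists (_, _).
- exact/dynkin_lambda_system.
- move=> _ [p _ <-]; split; first exact: measurable_obox.
  exact: fobox.
Qed.

(** In a rational box whose closed box lies in [U], the intersections with arbitrary boxes again
    have their closed boxes in [U], so the Dynkin argument applies there. Countably many such boxes
    exhaust [U]. *)
Lemma fundamental_lemma_bump n (U : set 'rV[R]_n) (f : 'rV[R]_n -> R) :
  open U -> (lebesgue_rV n).-integrable U (EFin \o f) ->
  (forall (k : R) (a b : 'rV[R]_n), 0 < k -> (forall i, a ord0 i < b ord0 i) -> cbox a b `<=` U ->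
     \int[lebesgue_rV n]_(x in U) (bumpn k a b x * f x) = 0) ->
  ae_eq (lebesgue_rV n) U f (cst 0).
Proof.
move=> oU fi f0; have mU := open_measurable_rV oU.
have box0 (p : 'rV[rat]_n * 'rV[rat]_n) : cbox (map_mx ratr p.1) (map_mx ratr p.2) `<=` U ->
    (lebesgue_rV n).-negligible
      (obox (map_mx ratr p.1) (map_mx ratr p.2) `&` [set x | f x != 0]).
  move=> pU; set B := obox _ _.
  have BU : B `<=` U by apply: subset_trans pU; exact: sub_obox_cbox.
  have : ae_eq (lebesgue_rV n) B f (cst 0).
    apply: ae_eq0_obox; first exact: measurable_obox.
    - by apply: integrableS fi => //; exact: measurable_obox.
    - exact: integral_obox0 fi f0 pU.
    - move=> a b; rewrite obox_setI; apply: integral_obox0 fi f0 _ => //.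
      apply: subset_trans pU => x xab i; have := xab i.
      rewrite /= !in_itv/= !mxE ge_max le_min.
      by move=> /andP[/andP[-> _] /andP[-> _]].
  apply: negligibleS => x [Bx fx] /(_ Bx)/eqP; exact/negP.
pose N p := [set x : 'rV[R]_n | cbox (map_mx ratr p.1) (map_mx ratr p.2) `<=` U] `&`
  (obox (map_mx ratr p.1) (map_mx ratr p.2) `&` [set x | f x != 0]).
have : (lebesgue_rV n).-negligible (\bigcup_p N p).
  apply: negligible_bigcup_countable => p.
  have [pU|pU] := pselect (cbox (map_mx ratr p.1) (map_mx ratr p.2) `<=` U).
    by apply: negligibleS (box0 p pU) => x [].
  by apply: negligibleS (negligible_set0 _) => x [].
apply: negligibleS => x /= /not_implyP[]; rewrite {1}(open_bigcup_obox oU).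
by move=> [p pU xp] /eqP fx; exists p.
Qed.

End FundamentalLemma.

(** * Products of one-variable functions: smoothness and integration by parts *)

Section ProductFunctions.
Context {R : realType}.
Local Notation leb := (@lebesgue_measure R).

Lemma continuous_muladd (T : topologicalType) (f g h : T -> R) :
  continuous f -> continuous g -> continuous h ->
  continuous (fun x => f x * g x + h x).
Proof. by move=> cf cg ch x; exact: (cvgD (cvgM (cf x) (cg x)) (ch x)). Qed.

Lemma continuous_prod_coord n (g : 'I_n -> R -> R) : (forall i, continuous (g i)) ->
  continuous (fun x : 'rV[R]_n => \prod_i g i (x ord0 i)).
Proof.
move=> cg; elim: (index_enum _) => [|i s IH].
  by under eq_fun do rewrite big_nil; exact: cst_continuous.
under eq_fun do rewrite big_cons.
move=> x; apply: continuousM; last exact: IH.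
by apply: continuous_comp; [exact: coord_continuous|exact: cg].
Qed.

Lemma is_derive_prod_coord n (g : 'I_n -> R -> R) (i : 'I_n) (x : 'rV[R]_n) (df : R) :
  is_derive (x ord0 i : R) (1 : R) (g i) df ->
  is_derive x (delta_mx ord0 i) (fun y : 'rV[R]_n => \prod_j g j (y ord0 j))
    (df * \prod_(j | j != i) g j (x ord0 j)).
Proof.
move=> [gd gdf]; set F := fun y : 'rV[R]_n => _; set c := \prod_(j | j != i) _.
have FE h : F (h *: delta_mx ord0 i + x) = g i (h + x ord0 i) * c.
  rewrite /F (bigD1 i)//= !mxE !eqxx mulr1; congr (_ * _).
  by apply: eq_bigr => j ji; rewrite !mxE (negbTE ji) andbF mulr0 add0r.
have Fx : F x = g i (x ord0 i) * c by rewrite /F (bigD1 i).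
have QE : (fun h : R => h^-1 *: ((F \o shift x) (h *: delta_mx ord0 i) - F x)) =
    (fun h => (h^-1 *: ((g i \o shift (x ord0 i)) (h *: (1 : R)) - g i (x ord0 i))) * c).
  apply/funext => h; rewrite /shift/= FE Fx /GRing.scale/= mulr1 -mulrBl.
  by rewrite mulrA.
have cvgF : (fun h : R => h^-1 *: ((F \o shift x) (h *: delta_mx ord0 i) - F x)) @ 0^' --> df * c.
  by rewrite QE; apply: cvgMr_tmp; rewrite -gdf.
split; first by apply/cvg_ex; exists (df * c).
exact: cvg_lim.
Qed.

Definition update n (g : 'I_n -> R -> R) i (f : R -> R) j := if j == i then f else g j.

Lemma update_prod n (g : 'I_n -> R -> R) i f (x : 'rV[R]_n) :
  \prod_j update g i f j (x ord0 j) = f (x ord0 i) * \prod_(j | j != i) g j (x ord0 j).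
Proof.
rewrite (bigD1 i)//= {1}/update eqxx; congr (_ * _).
by apply: eq_bigr => j /negbTE ji; rewrite /update ji.
Qed.

Lemma pderiv_prod_coord n (g : 'I_n -> R -> R) (i : 'I_n) (f' : R -> R) :
  (forall t, is_derive (t : R) (1 : R) (g i) (f' t)) ->
  pderiv i (fun x : 'rV[R]_n => \prod_j g j (x ord0 j)) =
  (fun x => \prod_j update g i f' j (x ord0 j)).
Proof.
move=> gf'; apply/funext => x; rewrite /pderiv.
have [_ ->] := is_derive_prod_coord (gf' (x ord0 i)).
by rewrite update_prod.
Qed.

Lemma class_C_prod_coord m n (g : 'I_n -> R -> R) : (forall i, smooth1 (g i)) ->
  class_C m (fun x : 'rV[R]_n => \prod_i g i (x ord0 i)).
Proof.
elim: m g => [|m IH] g sg; split=> //; try by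
  apply: continuous_prod_coord => i; exact: smooth1_continuous.
move=> i; have [f' sf' gf'] := smooth1_derive (sg i); split=> [x|].
  by have [] := is_derive_prod_coord (gf' (x ord0 i)).
rewrite (pderiv_prod_coord gf'); apply: IH => j.
by rewrite /update; case: ifP.
Qed.

Lemma smooth1_cst c : smooth1 (cst c : R -> R).
Proof.
exists (range (fun c (_ : R) => c)); first by exists c.
move=> _ [d _ <-]; exists (cst 0); first by exists 0.
by move=> t; exact: is_derive_cst.
Qed.

Lemma smooth1_id : smooth1 (id : R -> R).
Proof.
exists [set g | g = id \/ range (fun c (_ : R) => c) g]; first by left.
move=> _ [->|[d _ <-]].
  by exists (cst 1) => [|t]; [right; exists 1|exact: is_derive_id].
exists (cst 0); first by right; exists 0.
by move=> t; exact: is_derive_cst.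
Qed.

(** Seen as a product with all other factors 1, a coordinate inherits its smoothness and its
    derivatives from the lemmas on products. *)
Lemma coord_prodE n (i : 'I_n) : (fun x : 'rV[R]_n => x ord0 i) =
  (fun x => \prod_j update (fun=> cst 1) i id j (x ord0 j)).
Proof.
by apply/funext => x; rewrite update_prod big1 ?mulr1.
Qed.

Lemma class_C_coord m n (i : 'I_n) : class_C m (fun x : 'rV[R]_n => x ord0 i).
Proof.
rewrite coord_prodE; apply: class_C_prod_coord => j; rewrite /update.
by case: ifP => _; [exact: smooth1_id|exact: smooth1_cst].
Qed.

Lemma is_derive_coord n (i j : 'I_n) (x : 'rV[R]_n) :
  is_derive x (delta_mx ord0 i) (fun y : 'rV[R]_n => y ord0 j) (i == j)%:R.
Proof.
rewrite coord_prodE.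
have [->|ij] := eqVneq i j.
  have := @is_derive_prod_coord n (update (fun=> cst 1) j id) j x 1.
  rewrite big1 ?mulr1 => [|k /negbTE kj]; last by rewrite /update kj.
  by apply; rewrite /update eqxx; exact: is_derive_id.
have := @is_derive_prod_coord n (update (fun=> cst 1) j id) i x 0.
rewrite mul0r; apply; rewrite /update (negbTE ij); exact: is_derive_cst.
Qed.

Lemma class_C_cst m n (c : R) : class_C m (cst c : 'rV[R]_n -> R).
Proof.
elim: m c => [|m IH] c; split=> //; try exact: cst_continuous.
move=> i; split=> [x|]; first exact: derivable_cst.
by rewrite (_ : pderiv i _ = cst 0)//; apply/funext => x; rewrite /pderiv derive_cst.
Qed.

Lemma class_C_lin m n (c : R) (f g : 'rV[R]_n -> R) :
  class_C m f -> class_C m g -> class_C m (fun x => c * f x + g x).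
Proof.
have lin_continuous (f1 g1 : 'rV[R]_n -> R) : continuous f1 -> continuous g1 ->
    continuous (fun x : 'rV[R]_n => c * f1 x + g1 x).
  by apply: continuous_muladd; exact: cst_continuous.
elim: m f g => [f g [cf _] [cg _]|m IH f g [cf Cf] [cg Cg]].
  by split=> //; exact: lin_continuous.
split; first exact: lin_continuous.
move=> i; have [df Cf'] := Cf i; have [dg Cg'] := Cg i.
have D x : is_derive x (delta_mx ord0 i) (fun x => c * f x + g x)
    (c * pderiv i f x + pderiv i g x).
  apply: is_deriveD; last exact: DeriveDef.
  by apply: is_deriveZ; exact: DeriveDef.
split=> [x|]; first by have [] := D x.
rewrite (_ : pderiv i _ = fun x => c * pderiv i f x + pderiv i g x); first exact: IH.
by apply/funext => x; rewrite [LHS]/pderiv; have [_ ->] := D x.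
Qed.

Lemma bumpn_derive n k (a b : 'rV[R]_n) i : 0 < k -> exists f' : R -> R,
  [/\ continuous f',
   forall t, is_derive (t : R) (1 : R) (bump1 k (a ord0 i) (b ord0 i)) (f' t),
   forall t, t \notin `]a ord0 i, b ord0 i[ -> f' t = 0 &
   pderiv i (bumpn k a b) = fun x => \prod_j
     update (fun j => bump1 k (a ord0 j) (b ord0 j)) i f' j (x ord0 j)].
Proof.
move=> k0; have [f' [cf' bf' f'0]] := bump1_derive (a ord0 i) (b ord0 i) k0.
by exists f'; split=> //; exact: pderiv_prod_coord.
Qed.

Lemma pderiv_bumpn_out n k (a b : 'rV[R]_n) i x : 0 < k -> ~ obox a b x ->
  pderiv i (bumpn k a b) x = 0.
Proof.
move=> k0 /existsNP[j /negP xj].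
have [f' [_ _ f'0 ->]] := bumpn_derive a b i k0.
rewrite (bigD1 j)//= /update; case: eqP => [ji|_].
  by rewrite f'0 ?mul0r// -ji.
by rewrite [bump1 _ _ _ _]bump2_out ?mul0r.
Qed.

Lemma continuous_pderiv_bumpn n k (a b : 'rV[R]_n) i : 0 < k ->
  continuous (pderiv i (bumpn k a b)).
Proof.
move=> k0; have [f' [cf' _ _ ->]] := bumpn_derive a b i k0.
apply: continuous_prod_coord => j; rewrite /update; case: ifP => // _.
by apply: smooth1_continuous; exact: smooth1_bump1.
Qed.

(** Integration by parts against an affine function, term by term. The derivative [f'] of the i-th
    factor has integral 0, which removes [c] and the coordinates other than the i-th; the i-th one
    leaves the integral of [t * f' t], which is minus that of the factor. *)
Lemma Rintegral_pderiv_bumpn n k (a b : 'rV[R]_n) i (l : 'I_n -> R) c : 0 < k ->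
  (forall i, a ord0 i < b ord0 i) ->
  \int[lebesgue_rV n]_x (pderiv i (bumpn k a b) x * (c + \sum_j l j * x ord0 j)) =
  - l i * \int[lebesgue_rV n]_x bumpn k a b x.
Proof.
move=> k0 ab; have [f' [cf' bf' f'0 pE]] := bumpn_derive a b i k0.
pose psi j := bump1 k (a ord0 j) (b ord0 j).
have cpsi j : continuous (psi j) by apply: smooth1_continuous; exact: smooth1_bump1.
have psi0 j t : t \notin `[a ord0 j, b ord0 j] -> psi j t = 0.
  by move=> tab; apply: bump2_out => //; apply: contra tab; exact: subset_itv_oo_cc.
have f'00 t : t \notin `[a ord0 i, b ord0 i] -> f' t = 0.
  by move=> tab; apply: f'0; apply: contra tab; exact: subset_itv_oo_cc.
have ipsi j : leb.-integrable setT (EFin \o psi j).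
  exact: continuous_compact_supp_integrable (psi0 j).
have If' : \int[leb]_t f' t = 0.
  by have [] := Rintegral_derive_compact_supp (ab i) bf' cf' (fun t => bump2_out _ _ k0).
have if' : leb.-integrable setT (EFin \o f').
  exact: continuous_compact_supp_integrable f'00.
have iXf' : leb.-integrable setT (EFin \o (fun t => t * f' t)).
  apply: (@continuous_compact_supp_integrable _ _ (a ord0 i) (b ord0 i)).
    by move=> t; apply: cvgM => //; exact: cf'.
  by move=> t /f'00 ->; rewrite mulr0.
(* The integrand plus [psi i t] is the derivative of [t * psi i t], which vanishes outside the
   interval. *)
have IXf' : \int[leb]_t (t * f' t) = - \int[leb]_t psi i t.
  have D (t : R) : is_derive (t : R) (1 : R) (fun t => t * psi i t) (t * f' t + psi i t).
    refine (@is_derive_eq _ _ _ _ _ _ _ _ (is_deriveM (is_derive_id _ _) (bf' t)) _).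
    by rewrite /GRing.scale/= mulr1.
  have cD : continuous (fun t : R => t * f' t + psi i t).
    by apply: continuous_muladd => // t; exact: cvg_id.
  have D0 t : t \notin `]a ord0 i, b ord0 i[ -> t * psi i t = 0.
    by move=> tab; rewrite /psi [bump1 _ _ _ _]bump2_out// mulr0.
  have [_] := Rintegral_derive_compact_supp (ab i) D cD D0.
  by rewrite RintegralD// => /eqP; rewrite addr_eq0 => /eqP.
(* The factors of [x ord0 d] times the i-th derivative of the bump. The inner [update] is evaluated
   at [d], so that [d = i], where both changes fall on the same factor, is covered too. *)
pose g (d : 'I_n) (j : 'I_n) : R -> R :=
  update (update psi i f') d (fun t => t * update psi i f' d t) j.
have ig0 j : leb.-integrable setT (EFin \o update psi i f' j).
  by rewrite /update; case: ifP.
have ig d j : leb.-integrable setT (EFin \o g d j).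
  rewrite /g {1}/update; case: ifP => _; last exact: ig0.
  rewrite /update; case: ifP => // _.
  apply: (@continuous_compact_supp_integrable _ _ (a ord0 d) (b ord0 d)).
    by move=> t; apply: cvgM => //; exact: cpsi.
  by move=> t /psi0 ->; rewrite mulr0.
have gE d (x : 'rV[R]_n) : \prod_j g d j (x ord0 j) = x ord0 d * pderiv i (bumpn k a b) x.
  rewrite update_prod pE [in RHS](bigD1 d)//= mulrA; congr (_ * _).
have [ip Ip] := integrable_rV_prod ig0; have ipX d := (integrable_rV_prod (ig d)).1.
have IpX d : \int[lebesgue_rV n]_x (x ord0 d * pderiv i (bumpn k a b) x) =
    - (i == d)%:R * \int[lebesgue_rV n]_x bumpn k a b x.
  under eq_Rintegral do rewrite -gE; rewrite (integrable_rV_prod (ig d)).2.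
  have [<-|id_] := eqVneq i d.
    rewrite /bumpn (integrable_rV_prod ipsi).2 (bigD1 i)//= [in RHS](bigD1 i)//=.
    rewrite mulrA mulN1r; congr (_ * _).
      by rewrite /g /update !eqxx.
    by apply: eq_bigr => j /negbTE ji; rewrite /g /update ji.
  by rewrite oppr0 mul0r (bigD1 i)//= /g {1}/update (negbTE id_) /update eqxx If' mul0r.
have ipB : (lebesgue_rV n).-integrable setT (EFin \o pderiv i (bumpn k a b)).
  by rewrite pE.
have IpB : \int[lebesgue_rV n]_x pderiv i (bumpn k a b) x = 0.
  by rewrite pE Ip (bigD1 i)//= /update eqxx If' mul0r.
have ipX0 d : (lebesgue_rV n).-integrable setT
    (EFin \o (fun x : 'rV[R]_n => x ord0 d * pderiv i (bumpn k a b) x)).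
  by apply: (eq_integrable_EFin measurableT _ (ipX d)) => x _; rewrite gE.
have ipX' d : (lebesgue_rV n).-integrable setT
    (EFin \o (fun x : 'rV[R]_n => l d * (x ord0 d * pderiv i (bumpn k a b) x))).
  exact: integrableZl_EFin.
have [iS IS] := Rintegral_sum (index_enum 'I_n) (P := xpredT) measurableT (fun d _ => ipX' d).
under eq_Rintegral => x _.
  rewrite mulrDr mulr_sumr mulrC.
  under eq_bigr do rewrite mulrCA [pderiv _ _ _ * _]mulrC.
  over.
rewrite RintegralD//; last exact: integrableZl_EFin.
rewrite RintegralZl// IpB mulr0 add0r IS (bigD1 i)//= big1 => [|d di].
  by rewrite addr0 RintegralZl// IpX eqxx mulN1r mulrN mulNr.
by rewrite RintegralZl// IpX eq_sym (negbTE di) oppr0 mul0r mulr0.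
Qed.

End ProductFunctions.

(** * Signs of the exterior algebra as products over pairs *)

Section Signs.
Context {R : realType} {n : nat}.
Implicit Types (S A : {set 'I_n}) (i : 'I_n).

(** One sign per pair, negative for an inversion: [ins_sign] and [star_sign] become products, which
    can be split and merged like any big product. *)
Let sg (p q : 'I_n) : R := if (q < p)%N then -1 else 1.

Let sg_id i : sg i i = 1. Proof. by rewrite /sg ltnn. Qed.

Let sgN p q : p != q -> sg p q * sg q p = -1.
Proof. by rewrite /sg neq_ltn => /orP[] pq; rewrite pq ltnNge (ltnW pq)/= ?mulN1r ?mulrN1. Qed.

Lemma ins_sign_prod i S : ins_sign i S = \prod_(j in S) sg i j.
Proof.
rewrite /ins_sign -prodr_const -big_mkcondr/=.
by apply: eq_bigl => j; rewrite inE.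
Qed.

Lemma star_sign_prod A : star_sign A = \prod_(p in A) \prod_(q | q \notin A) sg p q.
Proof.
rewrite /star_sign -prodr_const.
under [RHS]eq_bigr do rewrite -big_mkcondr/=.
by rewrite pair_big_dep/=; apply: eq_bigl => -[p q];
  rewrite unfold_in /in_set/= asboolb andbA.
Qed.

Lemma ins_sign_sqr i S : ins_sign i S * ins_sign i S = 1 :> R.
Proof. by rewrite -expr2 sqrr_sign. Qed.

Lemma ins_sign_D1 i S : ins_sign i (S :\ i) = ins_sign i S :> R.
Proof.
rewrite /ins_sign; congr (_ ^+ _); apply: eq_card => j; rewrite !inE.
by have [->|] := eqVneq j i; rewrite ?ltnn ?andbF.
Qed.

(** Moving [i] from [S] to its complement affects only the pairs containing [i]. Those with the rest
    of [S] give [ins_sign i S]; each [p] outside [S] contributes [sg p i * sg i p = -1], hence the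
    power. With this sign the Hodge star turns contraction with x into exterior multiplication by
    x. *)
Lemma star_sign_ins_sign i S : i \in S ->
  star_sign (~: S) * ins_sign i (~: S) * ins_sign i S =
  (-1) ^+ #|~: S| * star_sign (~: (S :\ i)) :> R.
Proof.
move=> iS; pose T := S :\ i.
have SCE : ~: T = i |: ~: S by apply/setP => j; rewrite !inE negb_and negbK.
have -> : star_sign (~: T) =
    (\prod_(q in T) sg i q) * \prod_(p in ~: S) \prod_(q in T) sg p q.
  rewrite star_sign_prod SCE big_setU1 ?inE ?iS//= -SCE.
  by congr (_ * _); [|apply: eq_bigr => p _]; apply: eq_bigl => q; rewrite inE negbK.
have -> : ins_sign i S = \prod_(q in T) sg i q.
  by rewrite ins_sign_prod (big_setD1 i)//= sg_id mul1r.
have -> : star_sign (~: S) =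
    \prod_(p in ~: S) sg p i * \prod_(p in ~: S) \prod_(q in T) sg p q.
  rewrite star_sign_prod -big_split/=; apply: eq_bigr => p _.
  rewrite -(big_setD1 (F := fun q => sg p q) i iS).
  by apply: eq_bigl => q; rewrite inE negbK.
rewrite (ins_sign_prod i (~: S)) [_ * _ * \prod_(j in ~: S) _]mulrAC -big_split/=.
rewrite (eq_bigr (fun=> -1)) => [|p pS]; last first.
  by rewrite sgN//; apply: contraTneq pS => ->; rewrite inE negbK.
by rewrite prodr_const -mulrA [X in _ * X]mulrC.
Qed.

End Signs.

(** * Whitney forms and their Hodge duals in coordinates *)

Section AffineForms.
Context {R : realType} {n : nat}.
Implicit Types (k : nat) (x : 'rV[R]_n).

Lemma coef_val k (w : altform R n k) (s : ksubset k) : coef w (val s) = w s.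
Proof. by rewrite /coef valK. Qed.

Lemma coef_val_fun k (w : Defs.form R n k) (s : ksubset k) :
  (fun y => coef (w y) (val s)) = (fun y => w y s).
Proof. by apply/funext => y; rewrite coef_val. Qed.

Lemma ksubset_D1 k (S : @ksubset n k.+1) i : i \in val S ->
  exists2 s : @ksubset n k, val s = val S :\ i & true.
Proof.
move=> iS; have kP : #|val S :\ i| == k.
  by have := valP S; rewrite /= (cardsD1 i) iS add1n eqSS.
by exists (exist (fun A : {set 'I_n} => #|A| == k) _ kP).
Qed.

Lemma ksubset_U1 k (s : @ksubset n k) i : i \notin val s ->
  exists2 S : @ksubset n k.+1, val S = i |: val s & true.
Proof.
move=> iS; have kP : #|i |: val s| == k.+1.
  by rewrite cardsU1 iS add1n eqSS; exact: (valP s).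
by exists (exist (fun A : {set 'I_n} => #|A| == k.+1) _ kP).
Qed.

(** The sum runs over all [i], with coefficient 0 for [i] in [s], so that every coefficient of the
    form literally has the shape [c + \sum_i l i * x ord0 i] of the lemmas on affine functions. *)
Definition whitney k (a : altform R n k) (b : altform R n k.+1) : Defs.form R n k :=
  fun x => [ffun s => a s +
    \sum_i ((i \notin val s)%:R * ins_sign i (val s) * coef b (i |: val s)) * x ord0 i].

(** The form a + x /\ c, where x stands for the 1-form sum of the x_i dx^i: the Hodge dual of a
    constant form plus a Koszul term. *)
Definition star_whitney k (a : altform R n k.+1) (c : altform R n k) : Defs.form R n k.+1 :=
  fun x => [ffun s => a s +
    \sum_i ((i \in val s)%:R * ins_sign i (val s) * coef c (val s :\ i)) * x ord0 i].

Lemma P1minus_whitney k (w : Defs.form R n k) :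
  P1minus k w <-> exists a b, w = whitney a b.
Proof.
have wE (a : altform R n k) b : (fun=> a) \+ koszul (fun=> b) = whitney a b.
  apply/funext => x; apply/ffunP => s; rewrite !ffunE; congr (_ + _).
  rewrite big_mkcond/=; apply: eq_bigr => i _; case: (i \notin _).
    by rewrite mul1r mulrAC.
  by rewrite !mul0r.
split=> [[_ [a _ <-]] [_ [_ [b _ <-] <-]] <-|[a [b ->]]].
  by exists a, b; exact: wE.
exists (fun=> a); first by exists a.
by exists (koszul (fun=> b)); [exists (fun=> b) => //; exists b|exact: wE].
Qed.

Lemma P1starminus_star_whitney k (w : Defs.form R n k.+1) : P1starminus k.+1 w ->
  exists a c, w = star_whitney a c.
Proof.
move=> [v /P1minus_whitney[a [b ->]] <-].
exists [ffun S : ksubset k.+1 => star_sign (~: val S) * coef a (~: val S)].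
(* The sign is [(-1) ^+ #|~: S|] from [star_sign_ins_sign], since the complement of [S] has
   [n - k.+1] elements. *)
exists [ffun s : ksubset k => (-1) ^+ (n - k.+1) * star_sign (~: val s) * coef b (~: val s)].
apply/funext => x; apply/ffunP => S; rewrite !ffunE.
have cS : #|~: val S| == (n - k.+1)%N.
  by rewrite cardsCs finset.setCK card_ord (eqP (valP S)).
have -> : ~: val S = val (exist (fun A : {set 'I_n} => #|A| == (n - k.+1)%N) _ cS :
  ksubset (n - k.+1)) by [].
rewrite !coef_val !ffunE mulrDr mulr_sumr; congr (_ + _).
apply: eq_bigr => i _ /=; rewrite inE negbK mulrA; congr (_ * _).
have [iS|] := boolP (i \in val S); last by rewrite !mul0r mulr0.
rewrite !mul1r; have [s sE _] := ksubset_D1 iS; rewrite -sE coef_val ffunE sE.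
have -> : i |: ~: val S = ~: (val S :\ i).
  by apply/setP => j; rewrite !inE negb_and negbK.
have := star_sign_ins_sign (R := R) iS; rewrite (eqP cS) => <-.
rewrite -[LHS]mulr1 -(ins_sign_sqr i (val S)) /=; ring.
Qed.

Lemma class_C_affine m (c : R) (l : 'I_n -> R) :
  class_C m (fun x : 'rV[R]_n => c + \sum_i l i * x ord0 i).
Proof.
elim: (index_enum _) => [|i r IH].
  by under eq_fun do rewrite big_nil addr0; exact: class_C_cst.
under eq_fun do rewrite big_cons addrCA.
by apply: class_C_lin => //; exact: class_C_coord.
Qed.

Lemma whitney_smooth k (a : altform R n k) b : smooth_form (whitney a b).
Proof. by move=> s m; under eq_fun do rewrite ffunE; exact: class_C_affine. Qed.

Lemma is_derive_affine (c : R) (l : 'I_n -> R) i x :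
  is_derive x (delta_mx ord0 i) (fun y : 'rV[R]_n => c + \sum_j l j * y ord0 j) (l i).
Proof.
rewrite -[l i]add0r; apply: is_deriveD.
rewrite (_ : (fun _ => _) = \sum_j (l j \*: (fun y : 'rV[R]_n => y ord0 j))); last first.
  by apply/funext => y; rewrite fct_sumE.
have -> : l i = \sum_j l j *: ((i == j)%:R : R).
  rewrite (bigD1 i)//= eqxx /GRing.scale/= mulr1 big1 ?addr0// => j ji.
  by rewrite eq_sym (negbTE ji) mulr0.
by apply: is_derive_sum => j; apply: is_deriveZ; exact: is_derive_coord.
Qed.

Lemma pderiv_whitney k (a : altform R n k) b (s : ksubset k) i x :
  pderiv i (fun y => coef (whitney a b y) (val s)) x =
  (i \notin val s)%:R * ins_sign i (val s) * coef b (i |: val s).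
Proof.
rewrite /pderiv; under eq_fun do rewrite coef_val ffunE.
by have [_ ->] := is_derive_affine (a s)
  (fun i => (i \notin val s)%:R * ins_sign i (val s) * coef b (i |: val s)) i x.
Qed.

(** The homotopy formula d kappa b = (k+1) b for constant b: each of the [k.+1] indices of [S]
    contributes [b S], its two insertion signs cancelling. *)
Lemma extd_whitney k (a : altform R n k) b x :
  extd (whitney a b) x = [ffun S => k.+1%:R * b S].
Proof.
apply/ffunP => S; rewrite !ffunE.
have -> : k.+1%:R = #|val S|%:R :> R by rewrite (eqP (valP S)).
rewrite mulr_natl -sumr_const.
apply: eq_bigr => i iS; have [s sE _] := ksubset_D1 iS.
rewrite -sE pderiv_whitney sE !inE eqxx mul1r ins_sign_D1 finset.setD1K// coef_val.
by rewrite mulrA ins_sign_sqr mul1r.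
Qed.

End AffineForms.

(** * Square-integrable functions on a measurable set *)

Section SquareIntegrable.
Context d (T : measurableType d) (R : realType) (mu : {measure set T -> \bar R}).
Context (D : set T) (mD : measurable D).
Implicit Types f g : T -> R.

Definition L2 f := measurable_fun D f /\ mu.-integrable D (fun x => (f x ^+ 2)%:E).

Lemma L2_mul_integrable f g : L2 f -> L2 g ->
  mu.-integrable D (EFin \o (fun x => f x * g x)).
Proof.
move=> [mf fi] [mg gi]; apply: (le_integrable mD _ _ (integrableD_EFin mD fi gi)).
  by apply/measurable_EFinP; exact: measurable_funM.
move=> x _ /=; rewrite lee_fin [leRHS]ger0_norm ?addr_ge0 ?sqr_ge0//.
rewrite ler_norml; apply/andP; split; nra.
Qed.

Lemma L2_lin c f g : L2 f -> L2 g -> L2 (fun x => c * f x + g x).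
Proof.
move=> [mf fi] [mg gi]; split.
  by apply: measurable_funD => //; exact: measurable_funM.
apply: (le_integrable mD _ _ (integrableD_EFin mD
  (integrableZl_EFin mD (2 * c ^+ 2) fi) (integrableZl_EFin mD 2 gi))).
  apply/measurable_EFinP/measurable_funX.
  by apply: measurable_funD => //; exact: measurable_funM.
move=> x _ /=; rewrite lee_fin !ger0_norm ?sqr_ge0//.
  have := sqr_ge0 (c * f x - g x); rewrite !expr2; nra.
by rewrite addr_ge0 ?(mulr_ge0 _ (sqr_ge0 _))// mulr_ge0 ?sqr_ge0.
Qed.

Lemma L2_sum (I : Type) (s : seq I) (P : pred I) (F : I -> T -> R) :
  (forall i, P i -> L2 (F i)) -> L2 (fun x => \sum_(i <- s | P i) F i x).
Proof.
move=> LF; elim: s => [|i s IH].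
  rewrite (_ : (fun _ => _) = cst 0); last by apply/funext => x; rewrite big_nil.
  by split=> //; under eq_fun do rewrite expr0n/=; exact: integrable0.
have [Pi|Pi] := boolP (P i); last first.
  by rewrite (_ : (fun _ => _) = fun x => \sum_(i <- s | P i) F i x)//;
    apply/funext => x; rewrite big_cons (negbTE Pi).
rewrite (_ : (fun _ => _) = fun x => 1 * F i x + \sum_(i <- s | P i) F i x).
  by apply: L2_lin => //; exact: LF.
by apply/funext => x; rewrite big_cons Pi mul1r.
Qed.

Lemma L2_scale c f : L2 f -> L2 (fun x => c * f x).
Proof.
(* The empty sum supplies the zero function, so that [L2_lin] gives a pure multiple. *)
move=> Lf; have := @L2_sum bool [::] xpredT (fun _ => f) (fun _ _ => Lf).
move=> /(L2_lin c Lf); under eq_fun do rewrite big_nil addr0.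
exact.
Qed.

Lemma L2_bounded f (M : R) : (mu D < +oo)%E -> measurable_fun D f ->
  (forall x, D x -> `|f x| <= M) -> L2 f.
Proof.
move=> Doo mf fM; split=> //.
apply: (measurable_bounded_integrable (f := fun x => f x ^+ 2)) => //.
  exact: measurable_funX.
exists (M ^+ 2); split; first exact: num_real.
move=> N MN x /= Dx; apply: le_trans (ltW MN).
by rewrite normrX; apply: lerXn2r (fM _ Dx); rewrite nnegrE// (le_trans _ (fM _ Dx)).
Qed.

Lemma L2_integrable f : (mu D < +oo)%E -> L2 f -> mu.-integrable D (EFin \o f).
Proof.
move=> Doo Lf; have L1 : L2 (cst 1).
  by apply: (@L2_bounded _ 1) => // x _; rewrite normr1.
by apply: (eq_integrable_EFin mD _ (L2_mul_integrable Lf L1)) => x _; rewrite mulr1.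
Qed.

Lemma L2S (C : set T) f : measurable C -> C `<=` D -> L2 f ->
  measurable_fun C f /\ mu.-integrable C (fun x => (f x ^+ 2)%:E).
Proof.
by move=> mC CD [mf fi]; split; [exact: measurable_funS mf|exact: integrableS fi].
Qed.

End SquareIntegrable.

(** * Square-integrable forms, test forms and linearity of the weak codifferential *)

Section L2Forms.
Context {R : realType} {n : nat} (Omega : set 'rV[R]_n).
Local Notation mu := (@lebesgue_rV R n).
Local Notation form := (Defs.form R n).
Context (oO : open Omega) (bO : bounded_set Omega).

Let mO : measurable Omega. Proof. exact: open_measurable_rV. Qed.

Lemma Omega_lty : (mu Omega < +oo)%E.
Proof. exact: lebesgue_bounded_lty. Qed.

Lemma L2form_lin k c (v w : form k) : L2form Omega v -> L2form Omega w ->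
  L2form Omega (fun x => c *: v x + w x).
Proof.
move=> Lv Lw s; change (L2 mu Omega (fun x => (c *: v x + w x) s)).
under eq_fun do rewrite !ffunE.
exact: L2_lin.
Qed.

Lemma L2form_sub k (v w : form k) : L2form Omega v -> L2form Omega w ->
  L2form Omega (v \- w).
Proof.
move=> Lv Lw; have := L2form_lin (-1) Lw Lv.
by under eq_fun do rewrite scaleN1r addrC.
Qed.

Lemma inner_linl k c (u v w : form k) :
  L2form Omega u -> L2form Omega v -> L2form Omega w ->
  inner Omega (fun x => c *: u x + v x) w = c * inner Omega u w + inner Omega v w.
Proof.
move=> Lu Lv Lw; rewrite /inner mulr_sumr -big_split/=; apply: eq_bigr => s _.
have uwi := L2_mul_integrable mO (Lu s) (Lw s).
have vwi := L2_mul_integrable mO (Lv s) (Lw s).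
rewrite -RintegralZl// -RintegralD//; last exact: integrableZl_EFin.
by apply: eq_Rintegral => x _; rewrite !ffunE mulrDl mulrA.
Qed.

Lemma innerC k (u v : form k) : inner Omega u v = inner Omega v u.
Proof. by apply: eq_bigr => s _; apply: eq_Rintegral => x _; rewrite mulrC. Qed.

Lemma inner_linr k c (u v w : form k) :
  L2form Omega u -> L2form Omega v -> L2form Omega w ->
  inner Omega w (fun x => c *: u x + v x) = c * inner Omega w u + inner Omega w v.
Proof. by move=> Lu Lv Lw; rewrite innerC inner_linl// !(innerC w). Qed.

Lemma inner0 k (u : form k) : inner Omega u (fun=> 0) = 0.
Proof.
rewrite /inner big1// => s _.
by under eq_Rintegral do rewrite [X in _ * X]ffunE mulr0; rewrite Rintegral_cst// mul0r.
Qed.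

Lemma inner_ge0 k (u : form k) : 0 <= inner Omega u u.
Proof.
apply: sumr_ge0 => s _; apply: Rintegral_ge0 => x _.
by rewrite -expr2 sqr_ge0.
Qed.

(** The parallelogram law with the nonnegative square of [v - c u] dropped. It replaces the triangle
    inequality for the graph norm. *)
Lemma inner_lin_le k c (u v : form k) : L2form Omega u -> L2form Omega v ->
  inner Omega (fun x => c *: u x + v x) (fun x => c *: u x + v x) <=
  2 * c ^+ 2 * inner Omega u u + 2 * inner Omega v v.
Proof.
move=> Lu Lv; have Luv := L2form_lin c Lu Lv; have Luv' := L2form_lin (- c) Lu Lv.
have := inner_ge0 (fun x => (- c) *: u x + v x).
rewrite !inner_linl// !inner_linr// (innerC v u); nra.
Qed.

Lemma compact_supp_bounded (K : set 'rV[R]_n) (f : 'rV[R]_n -> R) :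
  compact K -> continuous f -> (forall x, ~ K x -> f x = 0) ->
  exists M, forall x, `|f x| <= M.
Proof.
move=> cK cf f0.
have : compact (f @` K) by apply: continuous_compact => //; exact: continuous_subspaceT.
move=> /compact_bounded[M [_ /(_ (`|M| + 1))]].
rewrite ltr_pwDr ?ler_norm// => /(_ isT) fM; exists (`|M| + 1) => x.
have [Kx|Kx] := pselect (K x); first by apply: fM; exists x.
by rewrite f0// normr0 addr_ge0.
Qed.

Lemma compact_supp_L2 (K : set 'rV[R]_n) (f : 'rV[R]_n -> R) :
  compact K -> continuous f -> (forall x, ~ K x -> f x = 0) -> L2 mu Omega f.
Proof.
move=> cK cf f0; have [M fM] := compact_supp_bounded cK cf f0.
apply: (@L2_bounded _ _ _ _ _ _ _ M) => //; first exact: Omega_lty.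
by apply: measurable_funTS; exact: continuous_measurable_rV.
Qed.

Lemma pderiv_out (K : set 'rV[R]_n) (f : 'rV[R]_n -> R) i :
  compact K -> (forall x, ~ K x -> f x = 0) -> forall x, ~ K x -> pderiv i f x = 0.
Proof.
move=> cK f0 x Kx; rewrite /pderiv -(derive_cst (0 : R) x (delta_mx ord0 i)).
apply: near_eq_derive.
have : nbhs x (~` K).
  apply: open_nbhs_nbhs; split=> //; apply: closed_openC.
  by apply: compact_closed => //; exact: norm_hausdorff.
by apply: filterS => y; exact: f0.
Qed.

Lemma smooth_pderiv_continuous k (w : form k) s i : smooth_form w ->
  continuous (pderiv i (fun y => w y s)).
Proof. by move=> /(_ s 1%N)[_ /(_ i)[_ []]]. Qed.

Lemma extdE k (w : form k) x (S : ksubset k.+1) :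
  extd w x S = \sum_(i in val S) ins_sign i (val S) *
    pderiv i (fun y => coef (w y) (val S :\ i)) x.
Proof. by rewrite ffunE. Qed.

Lemma test_form_L2 k (w : form k) : test_form Omega w -> L2form Omega w.
Proof.
move=> [sw [K [cK _ w0]]] s; apply: (compact_supp_L2 cK).
  by have [] := sw s 0%N.
by move=> x /w0 ->; rewrite ffunE.
Qed.

Lemma test_form_extd_L2 k (w : form k) : test_form Omega w -> L2form Omega (extd w).
Proof.
move=> [sw [K [cK _ w0]]] S; change (L2 mu Omega (fun x => extd w x S)).
under eq_fun do rewrite extdE.
apply: L2_sum => // i iS; apply: L2_scale => //.
have [s sE _] := ksubset_D1 iS; rewrite -sE coef_val_fun.
apply: (compact_supp_L2 cK); first exact: smooth_pderiv_continuous.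
have ws0 x : ~ K x -> w x s = 0 by move=> /w0 ->; rewrite ffunE.
exact: pderiv_out cK ws0.
Qed.

Lemma test_form_lin k c (v w : form k) : test_form Omega v -> test_form Omega w ->
  test_form Omega (fun x => c *: v x + w x).
Proof.
move=> [sv [K [cK KO v0]]] [sw [L [cL LO w0]]]; split.
  by move=> s m; under eq_fun do rewrite !ffunE; apply: class_C_lin.
exists (K `|` L); split; first exact: compactU.
  by move=> x []; [exact: KO|exact: LO].
move=> x /not_orP[Kx Lx]; rewrite v0// w0// scaler0 addr0//.
Qed.

Lemma codiff_lin k c (e1 e2 : form k.+1) (n1 n2 : form k) :
  codiff Omega e1 n1 -> codiff Omega e2 n2 ->
  codiff Omega (fun x => c *: e1 x + e2 x) (fun x => c *: n1 x + n2 x).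
Proof.
move=> [Le1 Ln1 c1] [Le2 Ln2 c2]; split; [exact: L2form_lin|exact: L2form_lin|].
move=> phi tphi; have Lphi := test_form_L2 tphi; have Ldphi := test_form_extd_L2 tphi.
by rewrite !inner_linr// c1// c2.
Qed.

Lemma Hstar_lin k c (e1 e2 : form k.+1) : Hstar Omega k e1 -> Hstar Omega k e2 ->
  Hstar Omega k (fun x => c *: e1 x + e2 x).
Proof.
by move=> [n1 c1] [n2 c2]; exists (fun x => c *: n1 x + n2 x); exact: codiff_lin.
Qed.

Lemma Hstar0_lin k c (e1 e2 : form k.+1) : Hstar0 Omega k e1 -> Hstar0 Omega k e2 ->
  Hstar0 Omega k (fun x => c *: e1 x + e2 x).
Proof.
move=> [n1 c1 h1] [n2 c2 h2]; exists (fun x => c *: n1 x + n2 x); first exact: codiff_lin.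
move=> e e0.
(* With this tolerance [t] one has [c ^+ 2 * t ^+ 2 <= (e / 2) ^+ 2], the added 1 covering [c = 0].
   By [inner_lin_le] the squared error is then below twice [(e / 2) ^+ 2] plus twice [(e / 2) ^+ 2],
   that is [e ^+ 2]. *)
have e10 : 0 < e / (2 * (`|c| + 1)) by rewrite divr_gt0// mulr_gt0// ltr_wpDl.
have [phi1 [psi1 [t1 d1 lt1]]] := h1 _ e10.
have [phi2 [psi2 [t2 d2 lt2]]] := h2 (e / 2) (divr_gt0 e0 (ltr0Sn _ _)).
exists (fun x => c *: phi1 x + phi2 x), (fun x => c *: psi1 x + psi2 x).
split; [exact: test_form_lin|exact: codiff_lin|].
have subE l (u v u' v' : form l) : (fun x => c *: u x + v x) \- (fun x => c *: u' x + v' x) =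
    (fun x => c *: (u \- u') x + (v \- v') x).
  by apply/funext => x /=; rewrite scalerBr opprD addrACA.
have sqrt_lt (x r : R) : 0 < r -> (Num.sqrt x < r) = (x < r ^+ 2).
  by move=> r0; rewrite -[in RHS]ltr_sqrt ?exprn_gt0// sqrtr_sqr gtr0_norm.
have [Le1 Ln1 _] := c1; have [Le2 Ln2 _] := c2.
have [Lp1 Ls1 _] := d1; have [Lp2 Ls2 _] := d2.
rewrite /graph_norm !subE sqrt_lt//.
move: lt1 lt2; rewrite /graph_norm !sqrt_lt ?divr_gt0//.
have := inner_lin_le c (L2form_sub Le1 Lp1) (L2form_sub Le2 Lp2).
have := inner_lin_le c (L2form_sub Ln1 Ls1) (L2form_sub Ln2 Ls2).
have := inner_ge0 (e1 \- phi1); have := inner_ge0 (n1 \- psi1).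
set X1 := inner _ _ _; set X2 := inner _ _ _; set Y1 := inner _ _ _; set Y2 := inner _ _ _.
set Z1 := inner _ _ _; set Z2 := inner _ _ _.
set t := e / (2 * (`|c| + 1)).
have ct : c ^+ 2 * t ^+ 2 <= (e / 2) ^+ 2.
  have -> : c ^+ 2 = `|c| ^+ 2 by rewrite -normrX ger0_norm ?sqr_ge0.
  rewrite -exprMn; apply: lerXn2r; rewrite ?nnegrE ?mulr_ge0 ?divr_ge0 ?(ltW e10) ?(ltW e0)//.
  have tE : t * (2 * (`|c| + 1)) = e by rewrite mulfVK// gt_eqF// mulr_gt0// ltr_wpDl.
  have := ltW e10; rewrite -/t; have := normr_ge0 c; nra.
move=> _ _ Y1le Z1le X12 YZ2.
have : c ^+ 2 * (X2 + X1) <= (e / 2) ^+ 2.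
  by apply: le_trans ct; rewrite ler_wpM2l ?sqr_ge0// ltW.
move: YZ2; rewrite (_ : (e / 2) ^+ 2 = e ^+ 2 / 4); first lra.
by rewrite exprMn exprVn -natrX.
Qed.

End L2Forms.

(** * The weak codifferential of a form that is affine on an open set *)

Section CellCodifferential.
Context {R : realType} {n : nat} (Omega : set 'rV[R]_n).
Local Notation mu := (@lebesgue_rV R n).
Local Notation form := (Defs.form R n).
Context (oO : open Omega) (bO : bounded_set Omega).

Let mO : measurable Omega. Proof. exact: open_measurable_rV. Qed.

Lemma compact_cbox (a b : 'rV[R]_n) : compact (cbox a b).
Proof.
apply: (@rV_compact R n (fun i => `[a ord0 i, b ord0 i]%classic)) => i.
exact: segment_compact.
Qed.

Definition bump_form k (K : R) (a b : 'rV[R]_n) (s0 : ksubset k) : form k :=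
  fun x => [ffun s => if s == s0 then bumpn K a b x else 0].

Lemma bump_form_test k K a b (s0 : ksubset k) : 0 < K -> cbox a b `<=` Omega ->
  test_form Omega (bump_form K a b s0).
Proof.
move=> K0 abO; split.
  move=> s m; under eq_fun do rewrite ffunE.
  have [_|_] := eqVneq s s0; last exact: class_C_cst.
  exact: (class_C_prod_coord m (fun i => smooth1_bump1 K (a ord0 i) (b ord0 i))).
exists (cbox a b); split=> //.
  exact: compact_cbox.
move=> x xab; apply/ffunP => s; rewrite !ffunE bumpn_out// ?if_same//.
by move=> /sub_obox_cbox.
Qed.

Lemma extd_bump_form k K a b (s0 : ksubset k) x (S : ksubset k.+1) :
  extd (bump_form K a b s0) x S =
  \sum_(i in val S | val S :\ i == val s0) ins_sign i (val S) * pderiv i (bumpn K a b) x.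
Proof.
rewrite extdE [RHS]big_mkcondr/=; apply: eq_bigr => i iS.
have [s sE _] := ksubset_D1 iS; rewrite -sE coef_val_fun (inj_eq val_inj).
have [->|ss0] := eqVneq s s0.
  by congr (_ * pderiv i _ x); apply/funext => y; rewrite ffunE eqxx.
rewrite (_ : (fun y => _) = cst 0); last first.
  by apply/funext => y; rewrite ffunE (negbTE ss0).
by rewrite /pderiv derive_cst mulr0.
Qed.

Lemma Rintegral_supp (C D : set 'rV[R]_n) (f : 'rV[R]_n -> R) : C `<=` D ->
  (forall x, ~ C x -> f x = 0) -> \int[mu]_(x in D) f x = \int[mu]_(x in C) f x.
Proof.
move=> CO f0; rewrite -(setIidr CO) Rintegral_mkcondr.
apply: eq_Rintegral => x _; rewrite patchE; case: ifPn => //.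
by rewrite notin_setE => /f0.
Qed.

Lemma Rintegral_ae_eq (C : set 'rV[R]_n) (f g : 'rV[R]_n -> R) : measurable C ->
  measurable_fun C f -> measurable_fun C g -> ae_eq mu C f g ->
  \int[mu]_(x in C) f x = \int[mu]_(x in C) g x.
Proof.
move=> mC mf mg fg; congr fine; apply: ae_eq_integral => //; try exact/measurable_EFinP.
by apply: filterS fg => x /[apply] ->.
Qed.

Lemma measurable_affine c (l : 'I_n -> R) :
  measurable_fun setT (fun x : 'rV[R]_n => c + \sum_j l j * x ord0 j).
Proof.
apply: measurable_funD => //; apply: measurable_sum => j.
by apply: measurable_funM => //; exact: measurable_coords.
Qed.

(** [l S i] is the i-th partial derivative of the coefficient of [eta] at [S], so the constant is
    the classical codifferential; its minus sign is that of the integration by parts. *)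
Lemma codiff_cell k (eta : form k.+1) (nu : form k) (C : set 'rV[R]_n)
    (c : ksubset k.+1 -> R) (l : ksubset k.+1 -> 'I_n -> R) :
  codiff Omega eta nu -> open C -> C `<=` Omega ->
  (forall S, ae_eq mu C (fun x => eta x S) (fun x => c S + \sum_j l S j * x ord0 j)) ->
  forall s, ae_eq mu C (fun x => nu x s)
    (cst (- \sum_(S : ksubset k.+1) \sum_(i in val S | val S :\ i == val s)
      ins_sign i (val S) * l S i)).
Proof.
move=> [Le Ln en] oC CO etaE s; set D := \sum_(S : ksubset k.+1) _.
have mC := open_measurable_rV oC.
have Coo : (mu C < +oo)%E.
  apply: le_lt_trans (Omega_lty oO bO).
  by apply: le_measure => //; exact/mem_set.
have meta S : measurable_fun C (fun x => eta x S).
  by apply: measurable_funS (Le S).1.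
have inus : mu.-integrable C (EFin \o (fun x => nu x s)).
  apply: (integrableS mO mC CO); apply: (L2_integrable mO _ (Ln s)).
  exact: Omega_lty.
(* In this form the claim is the fundamental lemma for the single function [nu x s + D] on [C]. *)
suff : ae_eq mu C (fun x => nu x s + D) (cst 0).
  by apply: filterS => x /[apply] /eqP; rewrite addr_eq0 => /eqP.
have iD : mu.-integrable C (EFin \o cst D).
  by apply: measurable_bounded_integrable => //; exact: bounded_cst.
apply: fundamental_lemma_bump => //; first exact: integrableD_EFin.
move=> K a b K0 ab abC.
have abO := subset_trans abC CO.
have out x : ~ C x -> ~ obox a b x by move=> Cx /sub_obox_cbox/abC.
have ibump : mu.-integrable C (EFin \o bumpn K a b).
  apply: measurable_bounded_integrable => //.
    by apply: measurable_funTS; exact: measurable_bumpn.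
  exists 1; split; first exact: num_real.
  move=> N N1 x _ /=; rewrite ger0_norm ?bumpn_ge0// (le_trans (bumpn_le1 _ _ _ _))//.
  exact: ltW.
have mpd i : measurable_fun setT (pderiv i (bumpn K a b)).
  by apply: continuous_measurable_rV; exact: continuous_pderiv_bumpn.
have key : inner Omega (bump_form K a b s) nu = \int[mu]_(x in C) (bumpn K a b x * nu x s).
  rewrite /inner (bigD1 s)//= big1 => [|s' s's]; last first.
    under eq_Rintegral do rewrite ffunE (negbTE s's) mul0r.
    by rewrite Rintegral_cst// mul0r.
  rewrite addr0 (Rintegral_supp CO).
    by apply: eq_Rintegral => x _; rewrite ffunE eqxx.
  by move=> x /out/bumpn_out; rewrite ffunE eqxx => -> //; rewrite mul0r.
(* The support of the bump allows three changes of domain: from [Omega] to [C], where [eta] can be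
   replaced by its affine expression, then to the whole space, where the integration by parts is
   available, and back to [C]. *)
have intS S i : \int[mu]_(x in Omega) (pderiv i (bumpn K a b) x * eta x S) =
    - l S i * \int[mu]_(x in C) bumpn K a b x.
  rewrite (Rintegral_supp CO); last first.
    by move=> x /out/pderiv_bumpn_out -> //; rewrite mul0r.
  transitivity (\int[mu]_(x in C) (pderiv i (bumpn K a b) x * (c S + \sum_j l S j * x ord0 j))).
    apply: Rintegral_ae_eq => //.
    - by apply: measurable_funM => //; exact: measurable_funTS.
    - apply: measurable_funM; apply: measurable_funTS => //.
      exact: measurable_affine.
    - by apply: filterS (etaE S) => x /[apply] ->.
  rewrite -(Rintegral_supp (@subsetT _ C)); last first.
    by move=> x /out/pderiv_bumpn_out -> //; rewrite mul0r.
  rewrite Rintegral_pderiv_bumpn// (Rintegral_supp (@subsetT _ C))//.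
  by move=> x /out/bumpn_out ->.
have Lpd i : L2 mu Omega (pderiv i (bumpn K a b)).
  apply: (compact_supp_L2 oO bO (@compact_cbox a b)); first exact: continuous_pderiv_bumpn.
  by move=> x xab; apply: pderiv_bumpn_out => // /sub_obox_cbox.
have dphi : inner Omega (extd (bump_form K a b s)) eta = - D * \int[mu]_(x in C) bumpn K a b x.
  rewrite /inner mulNr /D mulr_suml -sumrN; apply: eq_bigr => S _.
  under eq_Rintegral => x _.
    rewrite extd_bump_form mulr_suml; under eq_bigr do rewrite -mulrA.
    over.
  rewrite (Rintegral_sum _ _ _).2//; last first.
    by move=> i _; apply: integrableZl_EFin => //; exact: L2_mul_integrable.
  rewrite mulr_suml -sumrN; apply: eq_bigr => i _.
  rewrite RintegralZl//; last exact: L2_mul_integrable.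
  by rewrite intS mulNr mulrN mulrA.
have := en _ (bump_form_test s K0 abO); rewrite dphi key => e.
under eq_Rintegral do rewrite mulrDr.
rewrite RintegralD//.
- by rewrite -e RintegralZr// mulNr [D * _]mulrC addNr.
- apply: (L2_mul_integrable mC); last exact: (L2S mO mC CO (Ln s)).
  apply: (L2S mO mC CO); apply: (@L2_bounded _ _ _ _ _ _ _ 1) => //.
  + exact: Omega_lty.
  + by apply: measurable_funTS; exact: measurable_bumpn.
  + by move=> x _; rewrite ger0_norm ?bumpn_ge0// bumpn_le1.
- apply: (eq_integrable_EFin mC _ (integrableZl_EFin mC D ibump)) => x _.
  exact: mulrC.
Qed.

End CellCodifferential.

(** * Simplices in barycentric coordinates *)

Section Simplex.
Context {R : realType} {n : nat} (v : 'M[R]_(n.+1, n)).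
Local Notation mu := (@lebesgue_rV R n).
Context (hv : affinely_independent v).

Let A := \matrix_(i < n) (row (lift ord0 i) v - row ord0 v).
Let p0 := row ord0 v.

Let A_unit : A \in unitmx. Proof. by rewrite -row_free_unit. Qed.

(* The barycentric coordinates, except the one of the first vertex. *)
Let bary (x : 'rV[R]_n) : 'rV[R]_n := (x - p0) *m invmx A.

Let baryK x : x = p0 + bary x *m A.
Proof. by rewrite /bary mulmxKV// addrC subrK. Qed.

Let mulmx_vertices (t : 'rV[R]_n.+1) : \sum_i t ord0 i = 1 ->
  t *m v = p0 + (\row_j t ord0 (lift ord0 j)) *m A.
Proof.
move=> t1; rewrite !mulmx_sum_row big_ord_recl -/p0.
have -> : t ord0 ord0 = 1 - \sum_(j < n) t ord0 (lift ord0 j).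
  by rewrite -t1 big_ord_recl addrK.
rewrite scalerBl scale1r scaler_suml -addrA; congr (_ + _).
rewrite addrC -sumrB; apply: eq_bigr => j _.
by rewrite mxE rowK scalerBr.
Qed.

Lemma simplexP x : simplex v x <->
  (forall j, 0 <= bary x ord0 j) /\ \sum_j bary x ord0 j <= 1.
Proof.
split=> [[t [t0 t1 _ ->]]|[b0 b1]].
  have baryE : bary (t *m v) = \row_j t ord0 (lift ord0 j).
    by rewrite /bary mulmx_vertices// addrAC subrr add0r mulmxK.
  split=> [j|]; first by rewrite baryE mxE.
  under eq_bigr do rewrite baryE mxE.
  by rewrite -t1 [leRHS]big_ord_recl lerDr.
pose t : 'rV[R]_n.+1 := \row_i (if unlift ord0 i is Some j then bary x ord0 j
  else 1 - \sum_j bary x ord0 j).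
have t1 : \sum_i t ord0 i = 1.
  rewrite big_ord_recl [t ord0 ord0]mxE unlift_none.
  have -> : \sum_(j < n) t ord0 (lift ord0 j) = \sum_j bary x ord0 j.
    by apply: eq_bigr => j _; rewrite [t _ _]mxE liftK.
  by rewrite subrK.
exists t; split=> // [i|i|]; last 2 first.
- by rewrite inE.
- rewrite mulmx_vertices// [LHS]baryK; congr (_ + _ *m _).
  by apply/rowP => j; rewrite [RHS]mxE [t _ _]mxE liftK.
- by rewrite mxE; case: unliftP => [j _|_]; rewrite ?subr_ge0.
Qed.

(** Each coordinate in [bary], and their sum, which governs the coordinate of the first vertex, is
    such a function. This gives continuity for all of them and, when [u != 0], hyperplanes as level
    sets. *)
Let level (u : 'cV[R]_n) (x : 'rV[R]_n) : R := ((x - p0) *m u) ord0 ord0.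

Let level_affine u x : level u x = - (p0 *m u) ord0 ord0 + \sum_j u j ord0 * x ord0 j.
Proof.
rewrite /level mulmxBl [LHS]mxE addrC; congr (_ + _); first by rewrite [LHS]mxE.
by rewrite [LHS]mxE; apply: eq_bigr => j _; rewrite mulrC.
Qed.

Let continuous_level u : continuous (level u).
Proof.
rewrite (_ : level u = fun x => - (p0 *m u) ord0 ord0 + \sum_j u j ord0 * x ord0 j); last first.
  by apply/funext => x; exact: level_affine.
by have [] := class_C_affine 0 (- (p0 *m u) ord0 ord0) (fun j => u j ord0).
Qed.

Let bary_coord x j : bary x ord0 j = level (invmx A *m delta_mx j ord0) x.
Proof. by rewrite /level mulmxA -/(bary x) -colE [RHS]mxE. Qed.

Let bary_sum x : \sum_j bary x ord0 j = level (invmx A *m const_mx 1) x.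
Proof.
rewrite /level mulmxA -/(bary x) [RHS]mxE.
by apply: eq_bigr => j _; rewrite [X in _ * X]mxE mulr1.
Qed.

Let strict_cell x : (forall j, 0 < bary x ord0 j) -> \sum_j bary x ord0 j < 1 -> cell v x.
Proof.
move=> b0 b1; rewrite /cell /interior/=.
have nb0 j : \forall y \near x, 0 < bary y ord0 j.
  have := @continuous_level (invmx A *m delta_mx j ord0) x.
  move=> /cvgr_gt => /(_ 0); rewrite -bary_coord => /(_ (b0 j)).
  by apply: filterS => y; rewrite -bary_coord.
have nb1 : \forall y \near x, \sum_j bary y ord0 j < 1.
  have := @continuous_level (invmx A *m const_mx 1) x.
  move=> /cvgr_lt => /(_ 1); rewrite -bary_sum => /(_ b1).
  by apply: filterS => y; rewrite -bary_sum.
near=> y; apply/simplexP; split.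
  by move=> j; apply/ltW; move: j; near: y; exact: filter_forall.
by apply/ltW; near: y.
Unshelve. all: end_near. Qed.

Lemma cell_neq0 : cell v !=set0.
Proof.
have n0 : 0 < n.+1%:R :> R by rewrite ltr0n.
(* The barycentre: all [n.+1] barycentric coordinates are equal, and the [n] listed ones sum to less
   than 1. *)
pose t : 'rV[R]_n := const_mx n.+1%:R^-1.
exists (p0 + t *m A).
have bE : bary (p0 + t *m A) = t by rewrite /bary addrAC subrr add0r mulmxK.
apply: strict_cell => [j|]; rewrite bE; first by rewrite mxE invr_gt0.
under eq_bigr do rewrite mxE.
rewrite sumr_const card_ord -[ltLHS]mulr_natl ltr_pdivrMr// mul1r ltr_nat//.
Qed.

Let level_negligible (u : 'cV[R]_n) c : u != 0 ->
  mu.-negligible [set x | level u x = c].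
Proof.
move=> u0; apply: (@negligibleS _ _ _ mu (hyperplane u^T (c + (p0 *m u) ord0 ord0))).
  move=> x /=; rewrite level_affine => <-; rewrite /hyperplane/= addrAC addNr add0r.
  by apply: eq_bigr => j _; rewrite mxE.
apply/negligibleP; first exact: measurable_hyperplane.
apply: lebesgue_hyperplane; apply: contraNneq u0 => /(congr1 trmx).
by rewrite trmxK trmx0 => ->.
Qed.

(** A point whose [n.+1] barycentric coordinates are all positive is interior, so the difference
    lies in [n.+1] hyperplanes. Positivity of [n] makes [const_mx 1], the direction belonging to the
    first vertex, nonzero. *)
Lemma simplex_cell_negligible : (0 < n)%N -> mu.-negligible (simplex v `\` cell v).
Proof.
move=> n0.
have invA0 (e : 'cV[R]_n) : e != 0 -> invmx A *m e != 0.
  by apply: contraNneq => Ae0; rewrite -(mulKVmx A_unit e) Ae0 mulmx0.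
apply: (@negligibleS _ _ _ mu ((\bigcup_j [set x | bary x ord0 j = 0]) `|`
    [set x | \sum_j bary x ord0 j = 1])).
  move=> x [/simplexP[b0 b1] xv].
  have [b1'|b1'] := eqVneq (\sum_j bary x ord0 j) 1; first by right.
  left; apply: contrapT => bn0; apply: xv; apply: strict_cell; last first.
    by rewrite lt_neqAle b1' b1.
  move=> j; rewrite lt_neqAle b0 andbT; apply/eqP => bj0.
  by apply: bn0; exists j.
apply: negligibleU; first apply: negligible_bigcup_countable => j.
  under [X in mu.-negligible X]eq_set do rewrite bary_coord.
  apply: level_negligible; apply: invA0; apply/eqP => /colP/(_ j)/eqP.
  by rewrite !mxE !eqxx oner_eq0.
under [X in mu.-negligible X]eq_set do rewrite bary_sum.
apply: level_negligible; apply: invA0; apply/eqP => /colP/(_ (Ordinal n0))/eqP.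
by rewrite !mxE oner_eq0.
Qed.

End Simplex.

(** * Integrals and means over the cells of the mesh *)

Section Mesh.
Context {R : realType} {n : nat} (Omega : set 'rV[R]_n).
Context {I : finType} (T : I -> 'M[R]_(n.+1, n)).
Local Notation mu := (@lebesgue_rV R n).
Local Notation form := (Defs.form R n).
Context (hn : (1 <= n)%N) (oO : open Omega) (bO : bounded_set Omega).
Context (hT : simplicial_subdivision Omega T).
Local Notation C a := (cell (T a)).

Let mO : measurable Omega. Proof. exact: open_measurable_rV. Qed.

Lemma cell_open a : open (C a). Proof. exact: open_interior. Qed.

Lemma cell_measurable a : measurable (C a).
Proof. by apply: open_measurable_rV; exact: cell_open. Qed.

Lemma cell_Omega a : C a `<=` Omega. Proof. by have [_ _ + _ _] := hT; exact. Qed.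

Lemma cell_disjoint a b x : C a x -> C b x -> a = b.
Proof.
move=> ax bx; have [_ _ _ dis _] := hT; apply/eqP/negPn/negP => ab.
by have := dis _ _ ab; rewrite -subset0 => /(_ x); exact.
Qed.

Definition vol a : R := fine (mu (C a)).

Lemma cell_lty a : (mu (C a) < +oo)%E.
Proof.
apply: le_lt_trans (Omega_lty oO bO); apply: le_measure; last exact: cell_Omega.
- by apply/mem_set; exact: cell_measurable.
- exact/mem_set.
Qed.

Lemma vol_gt0 a : 0 < vol a.
Proof.
apply: fine_gt0; rewrite cell_lty andbT; apply: lebesgue_open_gt0; first exact: cell_open.
by apply: cell_neq0; have [+ _ _ _ _] := hT.
Qed.

(** The simplices cover the closure of [Omega] and have null boundaries; this is what lets integrals
    over [Omega] split over the open cells. *)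
Lemma Omega_cells_negligible : mu.-negligible (Omega `\` \bigcup_a C a).
Proof.
have [ai cov _ _ _] := hT.
apply: (@negligibleS _ _ _ mu (\bigcup_a (simplex (T a) `\` C a))).
  move=> x [Ox Cx]; have : (closure Omega) x by exact: subset_closure.
  rewrite cov => -[a _ ax]; exists a => //; split=> // Cax.
  by apply: Cx; exists a.
by apply: negligible_bigcup_countable => a; exact: simplex_cell_negligible.
Qed.

Lemma ae_eq_cells (V : Type) (f g : 'rV[R]_n -> V) :
  (forall a, f = g %[ae mu in C a]) -> f = g %[ae mu in Omega].
Proof.
move=> fg.
have : mu.-negligible ((\bigcup_a (C a `&` [set x | f x <> g x])) `|` (Omega `\` \bigcup_a C a)).
  apply: negligibleU; last exact: Omega_cells_negligible.
  apply: negligible_bigcup_countable => a; apply: negligibleS (fg a).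
  by move=> x [Cx fgx] /(_ Cx).
apply: negligibleS => x /= /not_implyP[Ox fgx].
have [[a _ ax]|nC] := pselect ((\bigcup_a C a) x); last by right.
by left; exists a.
Qed.

(** A cell has positive measure, so an almost everywhere equality is attained at some point of it.
    Applied to constants, it turns equality almost everywhere into equality. *)
Lemma ae_eq_cell_eq (V : Type) a (f g : 'rV[R]_n -> V) :
  f = g %[ae mu in C a] -> exists2 x, C a x & f x = g x.
Proof.
move=> fg; apply: contrapT => nfg.
have := vol_gt0 a; rewrite /vol.
have /negligibleP -> : mu.-negligible (C a).
- by apply: negligibleS fg => x Cx /(_ Cx) fgx; apply: nfg; exists x.
- by rewrite ltxx.
exact: cell_measurable.
Qed.

Lemma sum_indic_cells (f : 'rV[R]_n -> R) a x : C a x ->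
  \sum_b \1_(C b) x * f x = f x.
Proof.
move=> ax; rewrite (bigD1 a)//= big1 ?addr0 => [|b ba].
  by rewrite indicE mem_set// mul1r.
rewrite indicE memNset ?mul0r// => bx.
by move: ba; rewrite (cell_disjoint bx ax) eqxx.
Qed.

Lemma Rintegral_indic (A : set 'rV[R]_n) (f : 'rV[R]_n -> R) : A `<=` Omega ->
  \int[mu]_(x in Omega) (\1_A x * f x) = \int[mu]_(x in A) f x.
Proof.
move=> AO; rewrite -[in RHS](setIidr AO) Rintegral_mkcondr; apply: eq_Rintegral => x _.
by rewrite patchE indicE; case: ifP => _; rewrite ?mul1r ?mul0r.
Qed.

Lemma Rintegral_cells (f : 'rV[R]_n -> R) : mu.-integrable Omega (EFin \o f) ->
  \int[mu]_(x in Omega) f x = \sum_a \int[mu]_(x in C a) f x.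
Proof.
move=> fi; have mf : measurable_fun Omega f by apply/measurable_EFinP; exact: measurable_int fi.
have m1 a : measurable_fun Omega (\1_(C a) : 'rV[R]_n -> R).
  by apply: measurable_funTS; apply: measurable_indic; exact: cell_measurable.
have i1f a : mu.-integrable Omega (EFin \o (fun x => \1_(C a) x * f x)).
  apply: (le_integrable mO _ _ fi); first exact/measurable_EFinP/measurable_funM.
  move=> x _ /=; rewrite lee_fin normrM ler_piMl// indicE.
  by case: (_ \in _); rewrite ?normr1 ?normr0.
have [iS IS] := Rintegral_sum (index_enum I) (P := xpredT) mO (fun a _ => i1f a).
transitivity (\int[mu]_(x in Omega) \sum_a (\1_(C a) x * f x)).
  apply: Rintegral_ae_eq => //; first by apply/measurable_EFinP; exact: measurable_int iS.
  by apply: ae_eq_cells => a; apply: aeW => x ax; rewrite (sum_indic_cells _ ax).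
rewrite IS; apply: eq_bigr => a _; rewrite Rintegral_indic//; exact: cell_Omega.
Qed.

Definition mean a (f : 'rV[R]_n -> R) : R := (vol a)^-1 * \int[mu]_(x in C a) f x.

Lemma mean_cell a (f : 'rV[R]_n -> R) : \int[mu]_(x in C a) f x = vol a * mean a f.
Proof. by rewrite /mean mulVKf// gt_eqF// vol_gt0. Qed.

Lemma L2_cell a f : L2 mu Omega f -> mu.-integrable (C a) (EFin \o f).
Proof.
move=> Lf; apply: (integrableS mO (cell_measurable a) (@cell_Omega a)).
by apply: L2_integrable => //; exact: Omega_lty.
Qed.

Lemma mean_lin a c (f g : 'rV[R]_n -> R) : L2 mu Omega f -> L2 mu Omega g ->
  mean a (fun x => c * f x + g x) = c * mean a f + mean a g.
Proof.
move=> Lf Lg; have mC := cell_measurable a.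
have fi := L2_cell a Lf; have gi := L2_cell a Lg.
rewrite /mean RintegralD//; last exact: integrableZl_EFin.
by rewrite RintegralZl// mulrDr mulrCA.
Qed.

Lemma mean_ae a (f g : 'rV[R]_n -> R) : measurable_fun Omega f -> measurable_fun Omega g ->
  f = g %[ae mu in C a] -> mean a f = mean a g.
Proof.
move=> mf mg fg; rewrite /mean (@Rintegral_ae_eq _ _ (C a) f g)//.
- exact: cell_measurable.
- by apply: measurable_funS mf => //; exact: cell_Omega.
- by apply: measurable_funS mg => //; exact: cell_Omega.
Qed.

Lemma mean_cst a (c : R) : mean a (cst c) = c.
Proof.
rewrite /mean Rintegral_cst; last exact: cell_measurable.
by rewrite mulrC mulfK// gt_eqF// vol_gt0.
Qed.

(** Against a form that is constant on each cell only the cell means of the other form count. This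
    turns the pairing of forms into the weighted finite sums of the linear algebra, with the volumes
    as weights. *)
Lemma inner_cells_cst k (u v : form k) (c : I * ksubset k -> R) :
  L2form Omega u -> L2form Omega v ->
  (forall a s, ae_eq mu (C a) (fun x => v x s) (cst (c (a, s)))) ->
  inner Omega u v =
  \sum_p vol p.1 * mean p.1 (fun x => u x p.2) * c p.
Proof.
move=> Lu Lv vc; rewrite /inner.
transitivity (\sum_s \sum_a vol a * mean a (fun x => u x s) * c (a, s)).
  apply: eq_bigr => s _; rewrite Rintegral_cells; last exact: L2_mul_integrable.
  apply: eq_bigr => a _; have mC := cell_measurable a.
  have ui := L2_cell a (Lu s).
  have mu_ : measurable_fun (C a) (fun x => u x s).
    by apply: measurable_funS (Lu s).1 => //; exact: cell_Omega.
  have mv : measurable_fun (C a) (fun x => v x s).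
    by apply: measurable_funS (Lv s).1 => //; exact: cell_Omega.
  rewrite -mean_cell -RintegralZr//; apply: Rintegral_ae_eq => //.
  - exact: measurable_funM.
  - exact: measurable_funM.
  - by apply: filterS (vc a s) => x /[apply] ->.
rewrite exchange_big pair_big/=; apply: eq_bigr => -[a s] _ //.
Qed.

End Mesh.

(** * Piecewise Whitney forms and the two operators on a cell *)

Section PiecewiseWhitney.
Context {R : realType} {n : nat} (Omega : set 'rV[R]_n).
Context {I : finType} (T : I -> 'M[R]_(n.+1, n)).
Local Notation mu := (@lebesgue_rV R n).
Local Notation form := (Defs.form R n).
Context (oO : open Omega) (bO : bounded_set Omega).
Context (hT : simplicial_subdivision Omega T).
Local Notation C a := (cell (T a)).

Let mO : measurable Omega. Proof. exact: open_measurable_rV. Qed.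

Lemma ae_eq_form k a (u v : form k) : u = v %[ae mu in C a] <->
  forall s, ae_eq mu (C a) (fun x => u x s) (fun x => v x s).
Proof.
split=> [uv s|uv]; first by apply: filterS uv => x /[apply] ->.
have : \forall x \ae mu, forall s, C a x -> u x s = v x s by exact: filter_forall.
by apply: filterS => x uvx ax; apply/ffunP => s; exact: uvx.
Qed.

Lemma ae_eq_cst (V : Type) a (x y : V) : ae_eq mu (C a) (cst x) (cst y) -> x = y.
Proof. by move=> /(ae_eq_cell_eq oO bO hT)[]. Qed.

(** The set of [y] in the cell where the two functions differ is open; if it were nonempty it would
    have positive measure. *)
Lemma ae_eq_continuous a (f g : 'rV[R]_n -> R) : continuous f -> continuous g ->
  ae_eq mu (C a) f g -> forall x, C a x -> f x = g x.
Proof.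
move=> cf cg fg x ax; apply: contrapT => fgx.
pose U := C a `&` [set y | 0 < `|f y - g y|].
have oU : open U.
  apply: openI; first exact: cell_open.
  apply: (@open_comp _ _ (fun y => `|f y - g y|) [set r | 0 < r]); last exact: open_gt.
  by move=> y _; exact: (cvg_norm (cvgB (cf y) (cg y))).
have : (0 < mu U)%E.
  apply: lebesgue_open_gt0 => //; exists x; split=> //=.
  by rewrite normr_gt0 subr_eq0; exact/eqP.
rewrite (_ : mu U = 0) ?ltxx//; apply/negligibleP; first exact: open_measurable_rV.
apply: negligibleS fg => y [ay /= fgy] /(_ ay) fgE.
by move: fgy; rewrite fgE subrr normr0 ltxx.
Qed.

Lemma affine_L2 c (l : 'I_n -> R) :
  L2 mu Omega (fun x : 'rV[R]_n => c + \sum_j l j * x ord0 j).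
Proof.
have Oty := Omega_lty oO bO.
have Lc : L2 mu Omega (cst c).
  by apply: (@L2_bounded _ _ _ _ _ mO _ `|c|).
have Lx j : L2 mu Omega (fun x => x ord0 j).
  have [M [_ /(_ (`|M| + 1))]] := bO; rewrite ltr_pwDr ?ler_norm// => /(_ isT) OM.
  apply: (@L2_bounded _ _ _ _ _ mO _ (`|M| + 1)) => //.
    by apply: measurable_funTS; exact: measurable_coords.
  by move=> x /OM; apply: le_trans; exact: ler_coord_norm.
have Ll : L2 mu Omega (fun x => \sum_j l j * x ord0 j).
  by apply: L2_sum => // j _; exact: L2_scale.
have := L2_lin mO 1 Lc Ll.
by under eq_fun do rewrite mul1r.
Qed.

Lemma whitney_L2 k (a : altform R n k) b : L2form Omega (whitney a b).
Proof.
move=> s; change (L2 mu Omega (fun x => whitney a b x s)).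
by under eq_fun do rewrite ffunE; exact: affine_L2.
Qed.

Definition cellwise k (g : I -> form k) : form k := fun x => \sum_a \1_(C a) x *: g a x.

Lemma cellwiseE k (g : I -> form k) a x : C a x -> cellwise g x = g a x.
Proof.
move=> ax; rewrite /cellwise (bigD1 a)//= big1 ?addr0 => [|b ba].
  by rewrite indicE mem_set// scale1r.
rewrite indicE memNset ?scale0r// => bx.
by move: ba; rewrite (cell_disjoint hT bx ax) eqxx.
Qed.

Lemma cellwise_L2 k (g : I -> form k) : (forall a, L2form Omega (g a)) ->
  L2form Omega (cellwise g).
Proof.
move=> Lg s; change (L2 mu Omega (fun x => cellwise g x s)).
under eq_fun do rewrite /cellwise sum_ffunE.
apply: L2_sum => // a _; under eq_fun do rewrite ffunE.
have m1 : measurable_fun Omega (\1_(C a) : 'rV[R]_n -> R).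
  by apply: measurable_funTS; apply: measurable_indic; exact: cell_measurable.
have [mg ig] := Lg a s; split; first exact: measurable_funM.
apply: (le_integrable mO _ _ ig).
  by apply/measurable_EFinP/measurable_funX; exact: measurable_funM.
move=> x _ /=; rewrite lee_fin exprMn normrM ler_piMl// indicE.
by case: (_ \in _); rewrite ?expr1n ?expr0n ?normr1 ?normr0.
Qed.

(** The graph [dh] admits any smooth representative [p]. On the cell [p] is continuous and almost
    everywhere equal to the Whitney form, hence equal to it at every point of an open set, and so
    are the derivatives. *)
Lemma dh_cell k (w : form k) w' a al be : dh Omega T w w' ->
  w = whitney al be %[ae mu in C a] ->
  w' = (fun=> [ffun S => k.+1%:R * be S]) %[ae mu in C a].
Proof.
move=> [_ _ /(_ a)[p [sp wp w'p]]] wab.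
have pw : p = whitney al be %[ae mu in C a].
  by apply: filterS2 wp wab => x + + ax => /(_ ax) <- /(_ ax).
have pE x : C a x -> p x = whitney al be x.
  move=> ax; apply/ffunP => s; move: x ax.
  have /ae_eq_form/(_ s) := pw; apply: ae_eq_continuous.
    by have [] := sp s 0%N.
  by have [] := whitney_smooth al be s 0%N.
apply: filterS w'p => x w'px ax; rewrite (w'px ax) -(extd_whitney al be x).
apply/ffunP => S; rewrite !extdE; apply: eq_bigr => i _; congr (_ * _).
apply: near_eq_derive.
have : nbhs x (C a) by apply: open_nbhs_nbhs; split=> //; exact: cell_open.
by apply: filterS => y /pE ->.
Qed.

Lemma piecewise_P0P k (w : form k) : piecewise Omega T (P0 k) w <->
  L2form Omega w /\ exists c : I * ksubset k -> R,
    forall a s, ae_eq mu (C a) (fun x => w x s) (cst (c (a, s))).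
Proof.
split=> [[Lw wc]|[Lw [c wc]]]; split=> //.
  have /choice[c cP] : forall a, exists c : altform R n k, w = (fun=> c) %[ae mu in C a].
    by move=> a; have [_ [c _ <-] wE] := wc a; exists c.
  exists (fun p => c p.1 p.2) => a s.
  by have /ae_eq_form := cP a; exact.
move=> a; exists (fun=> [ffun s => c (a, s)]); first by exists [ffun s => c (a, s)].
by apply/ae_eq_form => s; apply: filterS (wc a s) => x /[apply] ->; rewrite ffunE.
Qed.

(* Equal to n - k; the sum is kept in the form in which integration by parts
   produces it, since only its sign matters. *)
Definition faces k (s : @ksubset n k) : R :=
  \sum_(S : @ksubset n k.+1) \sum_(i in val S | val S :\ i == val s) 1.

(** Any index outside [s] gives a term 1. Positivity of this factor is what makes a vanishing
    codifferential remove the linear part of a dual Whitney form. *)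
Lemma faces_gt0 k (s : @ksubset n k) : (k < n)%N -> 0 < faces s.
Proof.
move=> kn; have [i si] : exists i, i \notin val s.
  apply/existsP; apply: contraTT kn; rewrite negb_exists => /forallP sT.
  rewrite -leqNgt -(eqP (valP s)) -[X in (X <= _)%N]card_ord; apply: subset_leq_card.
  by apply/fintype.subsetP => i _; have := sT i; rewrite negbK.
have [S SE _] := ksubset_U1 si.
have iS : (i \in val S) && (val S :\ i == val s).
  by rewrite SE !inE eqxx/= setU1K.
apply: (lt_le_trans ltr01); rewrite /faces (bigD1 S)//= (bigD1 i)//= -addrA lerDl.
by rewrite addr_ge0// sumr_ge0// => S' _; rewrite sumr_ge0.
Qed.

(** The dual of the homotopy formula: delta (x /\ c) = -(n - k) c for a constant k-form c. The two
    insertion signs cancel in each of the terms that [faces] counts. *)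
Lemma codiff_star_whitney k (eta : form k.+1) nu a al c : codiff Omega eta nu ->
  eta = star_whitney al c %[ae mu in C a] ->
  forall s, ae_eq mu (C a) (fun x => nu x s) (cst (- (faces s * c s))).
Proof.
move=> en ew s.
have eE S : ae_eq mu (C a) (fun x => eta x S) (fun x => al S + \sum_j
    ((j \in val S)%:R * ins_sign j (val S) * coef c (val S :\ j)) * x ord0 j).
  by apply: filterS ew => x /[apply] ->; rewrite ffunE.
have := codiff_cell oO bO en (@cell_open _ _ _ _ a) (@cell_Omega _ _ _ _ _ hT a) eE s.
congr (ae_eq _ _ _ (cst (- _))); rewrite /faces mulr_suml; apply: eq_bigr => S _.
rewrite mulr_suml; apply: eq_bigr => i /andP[iS /eqP iSs].
by rewrite iS !mul1r iSs coef_val mulrA ins_sign_sqr mul1r.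
Qed.

End PiecewiseWhitney.

(** * Graphs of the two operators on the piecewise spaces, and interpolation *)

Section Decomposition.
Context {R : realType} {n : nat} (Omega : set 'rV[R]_n).
Context {I : finType} (T : I -> 'M[R]_(n.+1, n)).
Local Notation mu := (@lebesgue_rV R n).
Local Notation form := (Defs.form R n).
Context (hn : (1 <= n)%N) (oO : open Omega) (bO : bounded_set Omega).
Context (hT : simplicial_subdivision Omega T).
Local Notation C a := (cell (T a)).
Context {k : nat} (kn : (k < n)%N).

Let mO : measurable Omega. Proof. exact: open_measurable_rV. Qed.

Lemma codiff_ae (eta : form k.+1) (nu nu' : form k) : codiff Omega eta nu ->
  L2form Omega nu' -> (forall a, nu = nu' %[ae mu in C a]) -> codiff Omega eta nu'.
Proof.
move=> [Le Ln en] Ln' nn'; split=> // phi tphi; rewrite en//.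
have Lphi := test_form_L2 oO bO tphi.
apply: eq_bigr => s _; apply: Rintegral_ae_eq => //.
- exact: measurable_funM (Lphi s).1 (Ln s).1.
- exact: measurable_funM (Lphi s).1 (Ln' s).1.
- apply: (ae_eq_cells hn hT) => a; apply: filterS (nn' a) => x /[apply] ->//.
Qed.

Lemma dh_ae (w : form k) (w' v : form k.+1) : dh Omega T w w' -> L2form Omega v ->
  (forall a, v = w' %[ae mu in C a]) -> dh Omega T w v.
Proof.
move=> [Lw Lw' ww'] Lv vw'; split=> // a; have [p [sp wp w'p]] := ww' a.
exists p; split=> //.
by apply: filterS2 (vw' a) w'p => x + + ax => /(_ ax) -> /(_ ax).
Qed.

Lemma dh_whitney (w : form k) (w' : form k.+1) : piecewise Omega T (P1minus k) w ->
  dh Omega T w w' -> exists al be,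
  forall a, w = whitney (al a) (be a) %[ae mu in C a] /\
    w' = (fun=> [ffun S => k.+1%:R * be a S]) %[ae mu in C a].
Proof.
move=> [_ wP] ww'.
have /choice[q qP] : forall a, exists q : altform R n k * altform R n k.+1,
    w = whitney q.1 q.2 %[ae mu in C a].
  by move=> a; have [p /P1minus_whitney[al [be ->]] wE] := wP a; exists (al, be).
exists (fun a => (q a).1), (fun a => (q a).2) => a; split; first exact: qP.
exact: (dh_cell ww' (qP a)).
Qed.

Lemma dh_unique (w : form k) (w1 w2 : form k.+1) : piecewise Omega T (P1minus k) w ->
  dh Omega T w w1 -> dh Omega T w w2 -> forall a, w1 = w2 %[ae mu in C a].
Proof.
move=> wP w1P w2P a; have [al [be /(_ a)[wE w1E]]] := dh_whitney wP w1P.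
have w2E := dh_cell w2P wE.
by apply: filterS2 w1E w2E => x + + ax => /(_ ax) -> /(_ ax) ->.
Qed.

Lemma dh_P0 (w : form k) (w' : form k.+1) : piecewise Omega T (P1minus k) w ->
  dh Omega T w w' -> piecewise Omega T (P0 k.+1) w'.
Proof.
move=> wP ww'; have [al [be abE]] := dh_whitney wP ww'; have [_ Lw' _] := ww'.
split=> // a; exists (fun=> [ffun S => k.+1%:R * be a S]).
  by exists [ffun S => k.+1%:R * be a S].
by have [_ w'E] := abE a.
Qed.

Lemma dh_ker_P0 (w : form k) : piecewise Omega T (P1minus k) w ->
  dh Omega T w (fun=> 0) -> piecewise Omega T (P0 k) w.
Proof.
move=> wP ww'; have [al [be abE]] := dh_whitney wP ww'; have [Lw _ _] := ww'.
split=> // a; exists (fun=> al a); first by exists (al a).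
have [wE w'E] := abE a.
have be0 S : be a S = 0.
  have /ffunP/(_ S)/esym/eqP := ae_eq_cst oO bO hT w'E.
  by rewrite !ffunE mulf_eq0 pnatr_eq0 => /eqP.
apply: filterS wE => x /[apply] ->; apply/ffunP => s; rewrite ffunE big1 ?addr0// => i _.
have [si|] := boolP (i \notin val s); last by rewrite !mul0r.
by have [S SE _] := ksubset_U1 si; rewrite -SE coef_val be0 mulr0 mul0r.
Qed.

Lemma piecewise_P0_add l (v w : form l) : piecewise Omega T (P0 l) v ->
  piecewise Omega T (P0 l) w -> piecewise Omega T (P0 l) (v \+ w).
Proof.
move=> [Lv vP] [Lw wP]; split=> [|a].
  by have := L2form_lin oO 1 Lv Lw; under eq_fun do rewrite scale1r.
have [_ [c _ <-] vE] := vP a; have [_ [d _ <-] wE] := wP a.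
exists (fun=> c + d); first by exists (c + d).
by apply: filterS2 vE wE => x + + ax /= => /(_ ax) -> /(_ ax) ->.
Qed.

Lemma dh_cellwise (al : I -> altform R n k) (be : I -> altform R n k.+1) :
  dh Omega T (cellwise T (fun a => whitney (al a) (be a)))
    (cellwise T (fun a _ => [ffun S => k.+1%:R * be a S])).
Proof.
have Lcst l (c : altform R n l) : L2form Omega (fun=> c).
  move=> s; change (L2 mu Omega (cst (c s))).
  by apply: (@L2_bounded _ _ _ _ _ mO _ `|c s|) => //; exact: Omega_lty.
split=> [||a]; [by apply: cellwise_L2 => // a; exact: whitney_L2|exact: cellwise_L2|].
exists (whitney (al a) (be a)); split; first exact: whitney_smooth.
  by apply: aeW => x ax; rewrite (cellwiseE hT _ ax).
by apply: aeW => x ax; rewrite (cellwiseE hT _ ax) extd_whitney.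
Qed.

(** By [extd_whitney] the derivative fixes [be], up to the factor [k.+1]; the constant part [al]
    then corrects the mean without changing the derivative. The cells are independent of each other
    because no continuity is imposed between them. *)
Lemma whitney_interpolation (A : I * ksubset k -> R) (B : I * ksubset k.+1 -> R) :
  exists w w', [/\ piecewise Omega T (P1minus k) w, dh Omega T w w',
    forall p, mean T p.1 (fun x => w x p.2) = A p &
    forall a S, ae_eq mu (C a) (fun x => w' x S) (cst (B (a, S)))].
Proof.
pose be a : altform R n k.+1 := [ffun S => k.+1%:R^-1 * B (a, S)].
pose al a : altform R n k :=
  [ffun s => A (a, s) - mean T a (fun x => whitney (0 : altform R n k) (be a) x s)].
have dw := dh_cellwise al be; have [Lw Lw' _] := dw.
exists (cellwise T (fun a => whitney (al a) (be a))).
exists (cellwise T (fun a _ => [ffun S => k.+1%:R * be a S])).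
split=> // [|[a s]/=|a S].
- split=> // a; exists (whitney (al a) (be a)).
    by apply/P1minus_whitney; exists (al a), (be a).
  by apply: aeW => x ax; rewrite (cellwiseE hT _ ax).
- have Lwh := whitney_L2 oO bO (al a) (be a).
  have Lwh0 := whitney_L2 oO bO (0 : altform R n k) (be a).
  rewrite (mean_ae oO hT (Lw s).1 (Lwh s).1); last first.
    by apply: aeW => x ax; rewrite (cellwiseE hT _ ax).
  have LA : L2 mu Omega (cst (al a s)).
    by apply: (@L2_bounded _ _ _ _ _ mO _ `|al a s|) => //; exact: Omega_lty.
  rewrite (_ : (fun x => _) = fun x => 1 * cst (al a s) x + whitney 0 (be a) x s).
    by rewrite (mean_lin oO bO hT)// mul1r (mean_cst oO bO hT) ffunE subrK.
  by apply/funext => x; rewrite !ffunE mul1r /= ?ffunE add0r.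
- apply: aeW => x ax; rewrite (cellwiseE hT _ ax) !ffunE mulVKf//.
Qed.

(** * The finite data of a linear space of dual Whitney forms, and the decompositions *)

Context (M : set (form k.+1)).
Context (MP : M `<=` piecewise Omega T (P1starminus k.+1)).
Context (M0 : M (fun=> 0)).
Context (Ml : forall c eta1 eta2, M eta1 -> M eta2 -> M (fun x => c *: eta1 x + eta2 x)).

Lemma codiff_M (eta : form k.+1) nu : M eta -> codiff Omega eta nu ->
  exists al c, forall a, eta = star_whitney (al a) (c a) %[ae mu in C a] /\
    forall s, ae_eq mu (C a) (fun x => nu x s) (cst (- (faces s * c a s))).
Proof.
move=> Me en; have [_ eP] := MP Me.
have /choice[q qP] : forall a, exists q : altform R n k.+1 * altform R n k,
    eta = star_whitney q.1 q.2 %[ae mu in C a].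
  by move=> a; have [p /P1starminus_star_whitney[al [c ->]] eE] := eP a; exists (al, c).
exists (fun a => (q a).1), (fun a => (q a).2) => a; split; first exact: qP.
exact: (codiff_star_whitney oO bO hT en (qP a)).
Qed.

Lemma codiff_P0 (eta : form k.+1) nu : M eta -> codiff Omega eta nu ->
  piecewise Omega T (P0 k) nu.
Proof.
move=> Me en; have [al [c aE]] := codiff_M Me en; have [_ Ln _] := en.
apply/piecewise_P0P; split=> //; exists (fun p => - (faces p.2 * c p.1 p.2)) => a s.
by have [_ +] := aE a; exact.
Qed.

Lemma codiff_ker_P0 (eta : form k.+1) : M eta -> codiff Omega eta (fun=> 0) ->
  piecewise Omega T (P0 k.+1) eta.
Proof.
move=> Me en; have [al [c aE]] := codiff_M Me en; have [Le _ _] := en.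
split=> // a; exists (fun=> al a); first by exists (al a).
have [eE nE] := aE a.
have c0 s : c a s = 0.
  have : ae_eq mu (C a) (cst 0) (cst (- (faces s * c a s))).
    by apply: filterS (nE s) => x /[apply] <-; rewrite ffunE.
  move=> H; have /esym/eqP := ae_eq_cst oO bO hT H; rewrite oppr_eq0 mulf_eq0.
  by rewrite gt_eqF ?faces_gt0//= => /eqP.
apply: filterS eE => x /[apply] ->; apply/ffunP => S; rewrite ffunE big1 ?addr0// => i _.
have [iS|] := boolP (i \in val S); last by rewrite !mul0r.
by have [s sE _] := ksubset_D1 iS; rewrite -sE coef_val c0 mulr0 mul0r.
Qed.

(* M is W*_h or W*_h0.  As d_h w is constant on the cells for a Whitney form w,
   and so is delta eta for eta in M, these data of eta determine the pairing
   <w, delta eta> - <d_h w, eta>. *)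
Definition codiff_data (a' : I * ksubset k -> R) (b' : I * ksubset k.+1 -> R) :=
  exists eta nu, [/\ M eta, codiff Omega eta nu,
    forall a s, ae_eq mu (C a) (fun x => nu x s) (cst (a' (a, s))) &
    b' = fun p => mean T p.1 (fun x => eta x p.2)].

Lemma codiff0 : codiff Omega (fun=> 0 : altform R n k.+1) (fun=> 0 : altform R n k).
Proof.
have L0 l : L2form Omega (fun=> 0 : altform R n l).
  move=> s; change (L2 mu Omega (fun x : 'rV[R]_n => (0 : altform R n l) s)).
  by apply: (@L2_bounded _ _ _ _ _ mO _ 0) => [|//|x _]; rewrite ?ffunE ?normr0//; exact: Omega_lty.
by split=> // phi _; rewrite !inner0//.
Qed.

Lemma codiff_data_lin c a b a' b' : codiff_data a b -> codiff_data a' b' ->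
  codiff_data (fun p => c * a p + a' p) (fun p => c * b p + b' p).
Proof.
move=> [e1 [n1 [Me1 c1 a1 ->]]] [e2 [n2 [Me2 c2 a2 ->]]].
exists (fun x => c *: e1 x + e2 x), (fun x => c *: n1 x + n2 x); split.
- exact: Ml.
- exact: codiff_lin.
- move=> i s; apply: filterS2 (a1 i s) (a2 i s) => x + + ax.
  by move=> /(_ ax) + /(_ ax); rewrite !ffunE /= => -> ->.
- apply/funext => p; have [Le1 _ _] := c1; have [Le2 _ _] := c2.
  rewrite -(mean_lin oO bO hT)//; congr (mean _ _ _).
  by apply/funext => x; rewrite !ffunE.
Qed.

Lemma codiff_data0 : codiff_data (fun=> 0) (fun=> 0).
Proof.
exists (fun=> 0), (fun=> 0); split=> //; first exact: codiff0.
  by move=> a s; apply: aeW => x _; rewrite ffunE.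
apply/funext => p; rewrite -[LHS](mean_cst oO bO hT p.1); congr (mean _ _ _).
by apply/funext => x; rewrite ffunE.
Qed.

Lemma codiff_data_of (eta : form k.+1) nu : M eta -> codiff Omega eta nu ->
  exists2 a', forall a s, ae_eq mu (C a) (fun x => nu x s) (cst (a' (a, s))) &
    codiff_data a' (fun p => mean T p.1 (fun x => eta x p.2)).
Proof.
move=> Me en; have /piecewise_P0P[_ [a' a'E]] := codiff_P0 Me en.
by exists a' => //; exists eta, nu.
Qed.

(** The defining condition ranges over every [w'] and [nu] in the graphs, but all choices of [w']
    agree almost everywhere on the cells by [dh_unique], and [nu] enters only through its cell
    constants. The condition thus becomes the adjoint identity on data. *)
Lemma nonconforming_of_data (w : form k) (w0 : form k.+1)
    (A : I * ksubset k -> R) (B : I * ksubset k.+1 -> R) :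
  piecewise Omega T (P1minus k) w -> dh Omega T w w0 ->
  (forall p, mean T p.1 (fun x => w x p.2) = A p) ->
  (forall a S, ae_eq mu (C a) (fun x => w0 x S) (cst (B (a, S)))) ->
  (forall a' b', codiff_data a' b' ->
    \sum_p vol T p.1 * A p * a' p = \sum_q vol T q.1 * B q * b' q) ->
  nonconforming Omega T M w.
Proof.
move=> wP dw wA w0B AB; split=> // eta nu w' Me en dw'.
have [a' a'E eD] := codiff_data_of Me en.
have [Lw Lw' _] := dw'; have [Le Ln _] := en.
have w'B a S : ae_eq mu (C a) (fun x => w' x S) (cst (B (a, S))).
  apply: filterS2 (dh_unique wP dw dw' a) (w0B a S) => x + + ax.
  by move=> /(_ ax) <- /(_ ax).
rewrite (inner_cells_cst hn oO bO hT Lw Ln a'E) (innerC Omega w').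
rewrite (inner_cells_cst hn oO bO hT Le Lw' w'B).
under eq_bigr do rewrite wA.
rewrite (AB _ _ eD); apply/eqP; rewrite subr_eq0; apply/eqP.
by apply: eq_bigr => p _; rewrite mulrAC.
Qed.

Let data_decomposition := @linear_relation_decomposition R (I * ksubset k)%type
  (I * ksubset k.+1)%type (fun p => vol T p.1) (fun p => vol T p.1) codiff_data
  (fun p => vol_gt0 oO bO hT p.1) (fun p => vol_gt0 oO bO hT p.1)
  codiff_data0 codiff_data_lin.

Lemma dh_decomposition : orth_sum Omega (piecewise Omega T (P0 k.+1))
  (oprange (dh Omega T) (nonconforming Omega T M)) (opker (codiff Omega) M).
Proof.
split; last first.
  (* Orthogonality is the nonconforming condition on [v], read with codifferential 0. *)
  move=> w eta [v [vP vM] vw] [Me e0].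
  by have := vM eta _ w Me e0 vw; rewrite inner0// sub0r => /eqP; rewrite oppr_eq0 => /eqP.
apply/seteqP; split=> [w wP|_ [w [v [vP _] vw] [eta [Me e0] <-]]]; last first.
  exact: piecewise_P0_add (dh_P0 vP vw) (codiff_ker_P0 Me e0).
have /piecewise_P0P[Lw [b wb]] := wP.
have [A [b2 [[eta [nu [Me en n0 b2E]]] AB]]] := data_decomposition.1 b.
(* [n0] only says that [nu] vanishes almost everywhere on the cells; [codiff_ae] replaces it by the
   zero form, as [opker] requires. *)
have e0 : codiff Omega eta (fun=> 0).
  have [_ L0 _] := codiff0; apply: codiff_ae en L0 _ => a; apply/ae_eq_form => s.
  by apply: filterS (n0 a s) => x /[apply] ->; rewrite ffunE.
have /piecewise_P0P[Le [c ec]] := codiff_ker_P0 Me e0.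
(* [b2] was given as the means of [eta]; since [eta] is constant on each cell, these are its values,
   and [w \- eta] has the constants [b - b2]. *)
have b2c p : b2 p = c p.
  rewrite b2E -[RHS](mean_cst oO bO hT p.1); apply: (mean_ae oO hT (Le p.2).1) => //.
  by have := ec p.1 p.2; rewrite -surjective_pairing.
have [v [v' [vP dv vA v'B]]] := whitney_interpolation A (fun p => b p - b2 p).
exists (w \- eta); last by exists eta => //; apply/funext => x; rewrite /= subrK.
exists v; first exact: nonconforming_of_data vP dv vA v'B AB.
apply: (dh_ae dv) => [|a]; first exact: L2form_sub.
apply/ae_eq_form => S; apply: filterS3 (wb a S) (ec a S) (v'B a S) => x + + + ax.
by move=> /(_ ax) wE /(_ ax) eE /(_ ax) ->; rewrite !ffunE wE eE /= b2c.
Qed.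

Lemma codiff_decomposition : orth_sum Omega (piecewise Omega T (P0 k))
  (opker (dh Omega T) (nonconforming Omega T M)) (oprange (codiff Omega) M).
Proof.
split; last first.
  move=> v nu [[vP vM] dv] [eta Me en].
  by have := vM eta nu _ Me en dv; rewrite (innerC Omega (fun=> 0)) inner0// subr0.
apply/seteqP; split=> [w wP|_ [v [[vP _] dv] [nu [eta Me en] <-]]]; last first.
  exact: piecewise_P0_add (dh_ker_P0 vP dv) (codiff_P0 Me en).
have /piecewise_P0P[Lw [a1 wa]] := wP.
have [a2 [b2 [[eta [nu [Me en n2 b2E]]] AB]]] := data_decomposition.2 a1.
have [_ Ln _] := en.
exists (w \- nu); last by exists nu; [exists eta|apply/funext => x; rewrite /= subrK].
have vE a s : ae_eq mu (C a) (fun x => (w \- nu) x s) (cst (a1 (a, s) - a2 (a, s))).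
  apply: filterS2 (wa a s) (n2 a s) => x + + ax.
  by move=> /(_ ax) wE /(_ ax) nE; rewrite !ffunE wE nE.
have Lv : L2form Omega (w \- nu) by exact: L2form_sub.
(* A piecewise constant form is a Whitney form without Koszul part, so [w \- nu] lies in the domain
   of [dh] with derivative 0. *)
have vW a : (w \- nu) = whitney [ffun s => a1 (a, s) - a2 (a, s)] 0 %[ae mu in C a].
  apply/ae_eq_form => s; apply: filterS (vE a s) => x /[apply] ->.
  rewrite !ffunE big1 ?addr0// => j _.
  by rewrite /coef; case: insub => [S|]; rewrite ?ffunE mulr0 mul0r.
have vP : piecewise Omega T (P1minus k) (w \- nu).
  split=> // a; exists (whitney [ffun s => a1 (a, s) - a2 (a, s)] 0) => //.
  by apply/P1minus_whitney; exists [ffun s => a1 (a, s) - a2 (a, s)], 0.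
have dv : dh Omega T (w \- nu) (fun=> 0).
  split=> //; first by have [L0 _ _] := codiff0.
  move=> a; exists (whitney [ffun s => a1 (a, s) - a2 (a, s)] 0); split=> //.
    exact: whitney_smooth.
  by apply: aeW => x _; rewrite extd_whitney; apply/ffunP => S; rewrite !ffunE mulr0.
(* With derivative data 0 the adjoint identity says that [a1 - a2] is orthogonal to the
   codifferential data of [M], which is the property of the projection [a2]. *)
split=> //; apply: (nonconforming_of_data (A := fun p => a1 p - a2 p) (B := fun=> 0)
    vP dv) => [[a s]|a S|a' b' D] /=.
- rewrite -[RHS](mean_cst oO bO hT a); apply: (mean_ae oO hT (Lv s).1) => //.
  exact: vE.
- by apply: aeW => x _; rewrite ffunE.
- by rewrite (AB _ _ D) big1// => q _; rewrite mulr0 mul0r.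
Qed.

End Decomposition.

(** * Linearity of the two dual Whitney spaces, and the theorem *)

Section DualWhitneySpaces.
Context {R : realType} {n : nat} (Omega : set 'rV[R]_n).
Context {I : finType} (T : I -> 'M[R]_(n.+1, n)).
Local Notation form := (Defs.form R n).
Context (oO : open Omega) (bO : bounded_set Omega).

Lemma coef_lin k c (v w : altform R n k) (S : {set 'I_n}) :
  coef (c *: v + w) S = c * coef v S + coef w S.
Proof. by rewrite /coef; case: insub => [s|]; rewrite ?ffunE ?mulr0 ?addr0. Qed.

Lemma P1minus_lin k c (v w : form k) : P1minus k v -> P1minus k w ->
  P1minus k (fun x => c *: v x + w x).
Proof.
move=> /P1minus_whitney[a [b ->]] /P1minus_whitney[a' [b' ->]].
apply/P1minus_whitney; exists (c *: a + a'), (c *: b + b').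
apply/funext => x; apply/ffunP => s; rewrite !ffunE scalerDr scaler_sumr addrACA -big_split.
by congr (_ + _); apply: eq_bigr => j _; rewrite coef_lin /GRing.scale/=; ring.
Qed.

Lemma P1starminus_lin k c (v w : form k) : P1starminus k v -> P1starminus k w ->
  P1starminus k (fun x => c *: v x + w x).
Proof.
move=> [v' v'P <-] [w' w'P <-]; exists (fun x => c *: v' x + w' x); first exact: P1minus_lin.
by apply/funext => x; apply/ffunP => s; rewrite !ffunE coef_lin /GRing.scale/=; ring.
Qed.

Lemma P1starminus0 k : P1starminus k (fun=> 0 : altform R n k).
Proof.
exists (fun=> 0).
  apply/P1minus_whitney; exists 0, 0; apply/funext => x; apply/ffunP => s.
  rewrite !ffunE big1 ?addr0// => j _.
  by rewrite /coef; case: insub => [S|]; rewrite ?ffunE mulr0 mul0r.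
apply/funext => x; apply/ffunP => s; rewrite !ffunE /coef.
by case: insub => [S|]; rewrite ?ffunE mulr0.
Qed.

Lemma piecewise_lin k (V : set (form k)) :
  (forall c v w, V v -> V w -> V (fun x => c *: v x + w x)) ->
  forall c v w, piecewise Omega T V v -> piecewise Omega T V w ->
  piecewise Omega T V (fun x => c *: v x + w x).
Proof.
move=> Vl c v w [Lv vP] [Lw wP]; split=> [|a]; first exact: L2form_lin.
have [p Vp vp] := vP a; have [q Vq wq] := wP a.
exists (fun x => c *: p x + q x); first exact: Vl.
by apply: filterS2 vp wq => x + + ax => /(_ ax) -> /(_ ax) ->.
Qed.

Lemma Wstar_lin k c (u v : form k.+1) : Wstar Omega T k u -> Wstar Omega T k v ->
  Wstar Omega T k (fun x => c *: u x + v x).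
Proof.
move=> [uP uH] [vP vH]; split; last exact: Hstar_lin.
by apply: piecewise_lin => // *; exact: P1starminus_lin.
Qed.

Lemma Wstar0_lin k c (u v : form k.+1) : Wstar0 Omega T k u -> Wstar0 Omega T k v ->
  Wstar0 Omega T k (fun x => c *: u x + v x).
Proof.
move=> [uP uH] [vP vH]; split; last exact: Hstar0_lin.
by apply: piecewise_lin => // *; exact: P1starminus_lin.
Qed.

Lemma Wstar0_0 k : Wstar0 Omega T k (fun=> 0).
Proof.
have c0 := @codiff0 _ _ _ oO bO k.
split; last first.
  exists (fun=> 0) => // e e0; exists (fun=> 0), (fun=> 0); split=> //.
    split; last by exists set0; split=> //; exact: compact0.
    move=> s m; suff : class_C m (cst 0 : 'rV[R]_n -> R).
      by congr (class_C _ _); apply/funext => x; rewrite ffunE.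
    exact: class_C_cst.
  rewrite (_ : (_ \- _) = fun=> 0); last by apply/funext => x; rewrite /= subr0.
  rewrite (_ : (_ \- _) = fun=> 0); last by apply/funext => x; rewrite /= subr0.
  by rewrite /graph_norm !inner0// addr0 sqrtr0.
have [L0 _ _] := c0.
by split=> // a; exists (fun=> 0) => //; [exact: P1starminus0|exact: aeW].
Qed.

Lemma Wstar_0 k : Wstar Omega T k (fun=> 0).
Proof. by have [? [nu ? _]] := Wstar0_0 k; split=> //; exists nu. Qed.

End DualWhitneySpaces.

(* In the first part the degree of the decomposed space is k.+1, ranging over 1..n. *)
Theorem theorem3p12 (R : realType) (n : nat) (Omega : set 'rV[R]_n)
    (I : finType) (T : I -> 'M[R]_(n.+1, n))
    (hn : (1 <= n)%N)
    (hOmega : bounded_polyhedral_domain Omega)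
    (hT : simplicial_subdivision Omega T) :
  (forall k : nat, (k.+1 <= n)%N ->
     orth_sum Omega (piecewise Omega T (P0 k.+1))
       (oprange (dh Omega T) (Wnc Omega T k))
       (opker (codiff Omega) (Wstar0 Omega T k)) /\
     orth_sum Omega (piecewise Omega T (P0 k.+1))
       (oprange (dh Omega T) (Wnc0 Omega T k))
       (opker (codiff Omega) (Wstar Omega T k))) /\
  (forall k : nat, (k <= n.-1)%N ->
     orth_sum Omega (piecewise Omega T (P0 k))
       (opker (dh Omega T) (Wnc Omega T k))
       (oprange (codiff Omega) (Wstar0 Omega T k)) /\
     orth_sum Omega (piecewise Omega T (P0 k))
       (opker (dh Omega T) (Wnc0 Omega T k))
       (oprange (codiff Omega) (Wstar Omega T k))).
Proof.
have [oO _ _ bO _] := hOmega.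
have M0P k : Wstar0 Omega T k `<=` piecewise Omega T (P1starminus k.+1) by exact: subIsetl.
have MP k : Wstar Omega T k `<=` piecewise Omega T (P1starminus k.+1) by exact: subIsetl.
have M00 k := Wstar0_0 T oO bO k.
have M0 k := Wstar_0 T oO bO k.
have M0l k c := @Wstar0_lin _ _ _ _ T oO bO k c.
have Ml k c := @Wstar_lin _ _ _ _ T oO bO k c.
split=> k => [kn|_]; split.
(* The boundary condition sits on one side at a time: [Wnc] is tested against [Wstar0], and [Wnc0]
   against [Wstar]. So [M] is [Wstar0] in the first decomposition of each part and [Wstar] in the
   second. *)
- exact: (dh_decomposition hn oO bO hT kn (@M0P k) (M00 k) (M0l k)).
- exact: (dh_decomposition hn oO bO hT kn (@MP k) (M0 k) (Ml k)).
- exact: (codiff_decomposition hn oO bO hT (@M0P k) (M00 k) (M0l k)).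
- exact: (codiff_decomposition hn oO bO hT (@MP k) (M0 k) (Ml k)).
Qed.
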